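(* The set of true sentences of the fragment $\forall\exists_R\mathrm{PAD}^+$ is undecidable; that is, there is no algorithm that decides, given a sentence of $\forall\exists_R\mathrm{PAD}^+$, whether it is true over the integers.
   Context: Presburger arithmetic with divisibility (PAD) is the first-order theory of $\langle \mathbb{Z},0,1,+,<,\mid\rangle$, where $a \mid b$ iff there is $c\in\mathbb{Z}$ with $b=ac$. A linear polynomial over $\vec x=(x_1,\dots,x_n)$ is $\sum_i a_i x_i + b$ with $a_i,b\in\mathbb{Z}$. Quantifier-free PAD formulas are built from atoms $f(\vec x) < g(\vec x)$ and $f(\vec x)\mid g(\vec x)$ ($f,g$ linear polynomials) using $\land$ and $\lnot$ (with $\lor$, $\le$, $=$ as usual abbreviations). $\forall\exists_R\mathrm{PAD}$ is the set of PAD sentences of the form $\forall x_1\dots\forall x_n\exists y_1\dots\exists y_m\,\varphi(\vec x,\vec y)$ where $\varphi$ is quantifier-free and every divisibility atom in $\varphi$ has the form $f(\vec x)\mid g(\vec x,\vec y)$ (the existentially quantified variables do not occur on the left-hand side of divisibilities). $\forall\exists_R\mathrm{PAD}^+$ is the subset of $\forall\exists_R\mathrm{PAD}$ sentences in which negation is applied only to order atoms $<$, and the only other Boolean connectives are $\land$ and $\lor$ (so divisibility atoms occur only positively). *)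

(* Defs.v *)
From Stdlib Require Import ZArith List Arith.
Import ListNotations.
Open Scope Z_scope.

(** A linear polynomial over the universal variables x_0,...:
    (coefficients [a_0; a_1; ...], constant b) denotes sum_i a_i x_i + b. *)
Record linx := LinX { lx_coef : list Z; lx_const : Z }.

Record linxy := LinXY { lxy_xcoef : list Z; lxy_ycoef : list Z; lxy_const : Z }.

(** Positive quantifier-free formulas: negation only on order atoms,
    divisibility atoms f(x) | g(x,y) only positively, connectives and/or.
    (<=, = are abbreviations expressible with these.) *)
Inductive pfml :=
| PLt  (f g : linxy)
| PNLt (f g : linxy)
| PDvd (f : linx) (g : linxy)
| PAnd (p q : pfml)
| POr  (p q : pfml).

(** A sentence  forall x_0..x_{n-1} exists y_0..y_{m-1}, phi. *)
Record sentence := Sentence { s_nx : nat; s_ny : nat; s_body : pfml }.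

Definition wf_linx (n : nat) (f : linx) : Prop := (length (lx_coef f) <= n)%nat.
Definition wf_linxy (n m : nat) (f : linxy) : Prop :=
  (length (lxy_xcoef f) <= n)%nat /\ (length (lxy_ycoef f) <= m)%nat.

Fixpoint wf_pfml (n m : nat) (p : pfml) : Prop :=
  match p with
  | PLt f g | PNLt f g => wf_linxy n m f /\ wf_linxy n m g
  | PDvd f g => wf_linx n f /\ wf_linxy n m g
  | PAnd p q | POr p q => wf_pfml n m p /\ wf_pfml n m q
  end.

Definition wf_sentence (s : sentence) : Prop := wf_pfml (s_nx s) (s_ny s) (s_body s).

Fixpoint dot (cs vs : list Z) : Z :=
  match cs, vs with
  | c :: cs', v :: vs' => c * v + dot cs' vs'
  | _, _ => 0
  end.

Definition eval_linx (xs : list Z) (f : linx) : Z := dot (lx_coef f) xs + lx_const f.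
Definition eval_linxy (xs ys : list Z) (f : linxy) : Z :=
  dot (lxy_xcoef f) xs + dot (lxy_ycoef f) ys + lxy_const f.

(** [Z.divide a b] is  exists c, b = c * a  (so 0 | b iff b = 0). *)
Fixpoint holds (xs ys : list Z) (p : pfml) : Prop :=
  match p with
  | PLt f g => eval_linxy xs ys f < eval_linxy xs ys g
  | PNLt f g => ~ (eval_linxy xs ys f < eval_linxy xs ys g)
  | PDvd f g => Z.divide (eval_linx xs f) (eval_linxy xs ys g)
  | PAnd p q => holds xs ys p /\ holds xs ys q
  | POr p q => holds xs ys p \/ holds xs ys q
  end.

Definition true_sentence (s : sentence) : Prop :=
  forall xs : list Z, length xs = s_nx s ->
  exists ys : list Z, length ys = s_ny s /\ holds xs ys (s_body s).

Definition cpair (a b : nat) : nat := (((a + b) * (a + b + 1)) / 2 + b)%nat.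

Definition encZ (z : Z) : nat :=
  if (0 <=? z) then (2 * Z.to_nat z)%nat else (2 * Z.to_nat (- z) - 1)%nat.

Fixpoint encZs (l : list Z) : nat :=
  match l with
  | [] => 0%nat
  | z :: l' => S (cpair (encZ z) (encZs l'))
  end.

Definition enc_linx (f : linx) : nat := cpair (encZs (lx_coef f)) (encZ (lx_const f)).
Definition enc_linxy (f : linxy) : nat :=
  cpair (encZs (lxy_xcoef f)) (cpair (encZs (lxy_ycoef f)) (encZ (lxy_const f))).

Fixpoint enc_pfml (p : pfml) : nat :=
  match p with
  | PLt f g  => cpair 0 (cpair (enc_linxy f) (enc_linxy g))
  | PNLt f g => cpair 1 (cpair (enc_linxy f) (enc_linxy g))
  | PDvd f g => cpair 2 (cpair (enc_linx f) (enc_linxy g))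
  | PAnd p q => cpair 3 (cpair (enc_pfml p) (enc_pfml q))
  | POr p q  => cpair 4 (cpair (enc_pfml p) (enc_pfml q))
  end.

Definition enc_sentence (s : sentence) : nat :=
  cpair (s_nx s) (cpair (s_ny s) (enc_pfml (s_body s))).

Inductive instr :=
| INC (r : nat)
| DEC (r : nat) (j : nat).

Definition program := list instr.
Definition config : Type := (nat * (nat -> nat))%type.

Definition upd (regs : nat -> nat) (r v : nat) : nat -> nat :=
  fun r' => if Nat.eqb r' r then v else regs r'.

Inductive step (P : program) : config -> config -> Prop :=
| step_inc pc regs r :
    nth_error P pc = Some (INC r) ->
    step P (pc, regs) (S pc, upd regs r (S (regs r)))
| step_dec_zero pc regs r j :
    nth_error P pc = Some (DEC r j) -> regs r = 0%nat ->
    step P (pc, regs) (j, regs)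
| step_dec_succ pc regs r j k :
    nth_error P pc = Some (DEC r j) -> regs r = S k ->
    step P (pc, regs) (S pc, upd regs r k).

Inductive steps (P : program) : config -> config -> Prop :=
| steps_refl c : steps P c c
| steps_step c1 c2 c3 : step P c1 c2 -> steps P c2 c3 -> steps P c1 c3.

Definition halts_with (P : program) (k v : nat) : Prop :=
  exists pc regs,
    steps P (0%nat, fun r => if Nat.eqb r 0 then k else 0%nat) (pc, regs) /\
    (length P <= pc)%nat /\ regs 0%nat = v.

Definition decides_true_sentences (P : program) : Prop :=
  forall s : sentence, wf_sentence s ->
    (true_sentence s -> halts_with P (enc_sentence s) 1) /\
    (~ true_sentence s -> halts_with P (enc_sentence s) 0).

(* Main.v *)
Require Import Defs.
From Stdlib Require Import ZArith List Arith Znumtheory Lia.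
Import ListNotations.
Local Open Scope nat_scope.

(** A decider [P] would be contradicted by a sentence that speaks about its own code.  For a
    formula [p] with code [b], let [s_b] be the sentence [x_0 <> b \/ p], with [b] variables of
    each kind; its code [g b] is a polynomial in [b].  By the theorem of Matiyasevich, Robinson,
    Davis and Putnam, the relation "[P] halts on [g b] with output 1" is Diophantine in [b]:
    exponentiation is read off Pell equations, the bitwise order off the parity of binomial
    coefficients, and a whole computation of a counter machine is coded, as by Jones and
    Matijasevich, in the digits of a few numbers.  A Diophantine equation reduces to sums and
    squares, and failure of [z = x^2] is a positive existential statement about multiples of
    [x + 1] and [x + 2] in certain intervals.  Hence some [p] makes [s_b] true iff [P] does not
    halt on its code with output 1. *)

(** * Diophantine relations *)

(** A [forall exists] sentence can say that a system has no solution: every assignment violates some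
    atom. As divisibility may not be negated, each violation needs a positive witness; one violated
    atom is enough, so all atoms share a single existential variable. Squares are used instead of
    products because divisors are linear in the universal variables: the lcm of [x + 1] and [x + 2]
    is their product by coprimality, whereas arbitrary [x] and [y] may have common factors. The
    self-reference needs no fixed-point theorem: [p] does not contain its own code but takes it as
    input through [x_0], and the disjunct [x_0 <> b] outside [p] supplies the value. *)

Inductive atom (V : Set) : Set :=
| One (u : V)
| Add (u v w : V)
| Sq (u w : V).
Arguments One {V}.
Arguments Add {V}.
Arguments Sq {V}.

Definition ren {V W : Set} (f : V -> W) (a : atom V) : atom W :=
  match a with
  | One u => One (f u)
  | Add u v w => Add (f u) (f v) (f w)
  | Sq u w => Sq (f u) (f w)
  end.

Definition sat {V : Set} (e : V -> nat) (a : atom V) : Prop :=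
  match a with
  | One u => e u = 1
  | Add u v w => e u + e v = e w
  | Sq u w => e u * e u = e w
  end.

Definition sats {V : Set} (e : V -> nat) (l : list (atom V)) : Prop := Forall (sat e) l.

Lemma sats_ext {V : Set} (e e' : V -> nat) l :
  (forall v, e v = e' v) -> sats e l -> sats e' l.
Proof.
  intros E. apply Forall_impl.
  intros [] H; cbn in *; rewrite <- ?E; exact H.
Qed.

Lemma sats_ren {V W : Set} (f : V -> W) e l :
  sats e (map (ren f) l) <-> sats (fun v => e (f v)) l.
Proof.
  unfold sats. rewrite Forall_map.
  split; apply Forall_impl; intros []; cbn; auto.
Qed.

Lemma sats_app {V : Set} (e : V -> nat) l1 l2 : sats e (l1 ++ l2) <-> sats e l1 /\ sats e l2.
Proof. apply Forall_app. Qed.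

Definition join {V W : Set} (r : V -> nat) (m : W -> nat) (x : V + W) : nat :=
  match x with inl v => r v | inr w => m w end.

Definition ren_bound {V W : Set} (f : V -> W) (g : nat -> nat) (x : V + nat) : W + nat :=
  match x with inl v => inl (f v) | inr i => inr (g i) end.

(** The bound variables are numbered by all of [nat], so none has to be declared; a finite list
    mentions finitely many. The parameters form an arbitrary type, so that [option V] adds one. *)
Definition Dio {V : Set} (R : (V -> nat) -> Prop) : Prop :=
  exists l : list (atom (V + nat)), forall r, R r <-> exists m, sats (join r m) l.

Lemma dio_iff {V : Set} (R R' : (V -> nat) -> Prop) :
  (forall r, R r <-> R' r) -> Dio R' -> Dio R.
Proof.
  intros E [l H]. exists l. intros r. rewrite E. apply H.
Qed.

Lemma dio_atom {V : Set} (a : atom V) : Dio (fun r => sat r a).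
Proof.
  exists [ren inl a]. intros r. split.
  - intros H. exists (fun _ => 0). constructor; [|constructor].
    destruct a; exact H.
  - intros [m H]. inversion H; subst. destruct a; assumption.
Qed.

(** Keeps the bound variables of two systems apart: even indices for one, odd indices for the
    other. *)
Definition interleave (m1 m2 : nat -> nat) (i : nat) : nat :=
  if Nat.even i then m1 (Nat.div2 i) else m2 (Nat.div2 i).

Lemma interleave_even m1 m2 i : interleave m1 m2 (2 * i) = m1 i.
Proof.
  unfold interleave. rewrite Nat.even_mul, Nat.div2_double. reflexivity.
Qed.

Lemma interleave_odd m1 m2 i : interleave m1 m2 (S (2 * i)) = m2 i.
Proof.
  unfold interleave. rewrite Nat.even_succ, Nat.odd_mul, Nat.div2_succ_double. reflexivity.
Qed.

Lemma dio_and {V : Set} (R R' : (V -> nat) -> Prop) :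
  Dio R -> Dio R' -> Dio (fun r => R r /\ R' r).
Proof.
  intros [l1 H1] [l2 H2].
  exists (map (ren (ren_bound (fun v => v) (fun i => 2 * i))) l1
    ++ map (ren (ren_bound (fun v => v) (fun i => S (2 * i)))) l2).
  intros r. rewrite H1, H2. split.
  - intros [[m1 E1] [m2 E2]]. exists (interleave m1 m2).
    apply sats_app. split; apply sats_ren.
    + revert E1. apply sats_ext. intros [v|i]; cbn [join ren_bound]; [reflexivity|].
      now rewrite interleave_even.
    + revert E2. apply sats_ext. intros [v|i]; cbn [join ren_bound]; [reflexivity|].
      now rewrite interleave_odd.
  - intros [m E]. apply sats_app in E. destruct E as [E1 E2].
    rewrite sats_ren in E1. rewrite sats_ren in E2. split.
    + exists (fun i => m (2 * i)). revert E1. apply sats_ext. intros [v|i]; reflexivity.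
    + exists (fun i => m (S (2 * i))). revert E2. apply sats_ext. intros [v|i]; reflexivity.
Qed.

Lemma dio_true {V : Set} : Dio (fun _ : V -> nat => True).
Proof.
  exists []. intros r. split; [|easy]. intros _. exists (fun _ => 0). constructor.
Qed.

Lemma dio_ren {V W : Set} (f : V -> W) (R : (V -> nat) -> Prop) :
  Dio R -> Dio (fun r => R (fun v => r (f v))).
Proof.
  intros [l H].
  exists (map (ren (ren_bound f (fun i => i))) l).
  intros r. rewrite H.
  split; intros [m E]; exists m.
  - apply sats_ren. revert E. apply sats_ext. intros [v|i]; reflexivity.
  - rewrite sats_ren in E. revert E. apply sats_ext. intros [v|i]; reflexivity.
Qed.

(** A whole sequence can be quantified at once because a finite system reads only finitely many of
    its entries. This serves for families of numbers such as one per counter or per transition. *)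
Lemma dio_exfun {V : Set} (R : (nat -> nat) -> (V -> nat) -> Prop) :
  Dio (fun r : nat + V -> nat => R (fun i => r (inl i)) (fun v => r (inr v))) ->
  Dio (fun r => exists c, R c r).
Proof.
  intros [l H].
  exists (map (ren (fun x : nat + V + nat => match x with
    | inl (inl i) => inr (2 * i)
    | inl (inr v) => inl v
    | inr i => inr (S (2 * i)) end : V + nat)) l).
  intros r. split.
  - intros [c E]. apply (H (join c r)) in E. destruct E as [m E].
    exists (interleave c m). apply sats_ren. revert E. apply sats_ext.
    intros [[i|v]|i]; cbn [join ren_bound]; [|reflexivity|].
    + now rewrite interleave_even.
    + now rewrite interleave_odd.
  - intros [m E]. exists (fun i => m (2 * i)).
    apply (H (join (fun i => m (2 * i)) r)). rewrite sats_ren in E.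
    exists (fun i => m (S (2 * i))). revert E. apply sats_ext.
    intros [[i|v]|i]; reflexivity.
Qed.

Lemma dio_ex {V : Set} (R : nat -> (V -> nat) -> Prop) :
  Dio (fun r : option V -> nat => R (r None) (fun v => r (Some v))) ->
  Dio (fun r => exists x, R x r).
Proof.
  intros H. apply dio_iff with (R' := fun r => exists c, (fun c r => R (c 0) r) c r).
  - intros r. split; [intros [x E]; now exists (fun _ => x)|intros [c E]; now exists (c 0)].
  - apply dio_exfun.
    exact (dio_ren (fun x => match x with None => inl 0 | Some v => inr v end) _ H).
Qed.

Definition DioFun {V : Set} (e : (V -> nat) -> nat) : Prop :=
  Dio (fun r : option V -> nat => r None = e (fun v => r (Some v))).

Definition lift {V : Set} (x : option V) : option (option V) :=
  match x with None => None | Some v => Some (Some v) end.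

Lemma dio_subst2 {V : Set} (R : nat -> nat -> Prop) (e1 e2 : (V -> nat) -> nat) :
  Dio (fun r : bool -> nat => R (r true) (r false)) ->
  DioFun e1 -> DioFun e2 -> Dio (fun r => R (e1 r) (e2 r)).
Proof.
  intros HR H1 H2.
  apply dio_iff with (R' := fun r => exists x, x = e1 r /\ exists y, y = e2 r /\ R x y).
  - intros r. split; [eauto 6|intros [x [-> [y [-> E]]]]; exact E].
  - apply dio_ex, dio_and; [exact H1|]. apply dio_ex, dio_and; [exact (dio_ren lift _ H2)|].
    exact (dio_ren (fun b : bool => if b then Some None else None) _ HR).
Qed.

Lemma dio_subst3 {V : Set} (R : nat -> nat -> nat -> Prop) (e1 e2 e3 : (V -> nat) -> nat) :
  Dio (fun r : nat -> nat => R (r 0) (r 1) (r 2)) ->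
  DioFun e1 -> DioFun e2 -> DioFun e3 -> Dio (fun r => R (e1 r) (e2 r) (e3 r)).
Proof.
  intros HR H1 H2 H3.
  apply dio_iff with
    (R' := fun r => exists x, x = e1 r /\ exists y, y = e2 r /\ exists z, z = e3 r /\ R x y z).
  - intros r. split; [eauto 8|intros [x [-> [y [-> [z [-> E]]]]]]; exact E].
  - apply dio_ex, dio_and; [exact H1|]. apply dio_ex, dio_and; [exact (dio_ren lift _ H2)|].
    apply dio_ex, dio_and.
    + exact (dio_ren (fun x => match x with None => None | Some v => Some (Some (Some v)) end) _ H3).
    + exact (dio_ren (fun i => match i with
        | 0 => Some (Some None) | 1 => Some None | _ => None end) _ HR).
Qed.

Lemma dio_var {V : Set} (v : V) : DioFun (fun r => r v).
Proof.
  (* No atom equates two variables; cancelling a common summand [z] does it. *)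
  apply dio_iff with (R' := fun r : option V -> nat =>
    exists z, exists w, r None + z = w /\ r (Some v) + z = w).
  - intros r. split.
    + intros E. exists 0, (r None). lia.
    + intros [z [w H]]. lia.
  - apply dio_ex, dio_ex, dio_and.
    + exact (dio_atom (Add (Some (Some None)) (Some None) None)).
    + exact (dio_atom (Add (Some (Some (Some v))) (Some None) None)).
Qed.

Lemma dio_const {V : Set} (c : nat) : DioFun (fun _ : V -> nat => c).
Proof.
  induction c as [|c IH].
  - apply dio_iff with (R' := fun r : option V -> nat => r None + r None = r None); [lia|].
    exact (dio_atom (Add None None None)).
  - apply dio_iff with (R' := fun r : option V -> nat =>
      exists u, u = 1 /\ exists x, x = c /\ x + u = r None).
    + intros r. split; [intros ->; exists 1; split; [reflexivity|]; exists c; lia|].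
      intros [u [-> [x [-> E]]]]. lia.
    + apply dio_ex, dio_and; [exact (dio_atom (One None))|].
      apply dio_ex, dio_and.
      * exact (dio_ren (fun x => match x with None => None | Some v => Some (Some (Some v)) end) _ IH).
      * exact (dio_atom (Add None (Some None) (Some (Some None)))).
Qed.

Lemma dio_eq {V : Set} (e1 e2 : (V -> nat) -> nat) :
  DioFun e1 -> DioFun e2 -> Dio (fun r => e1 r = e2 r).
Proof.
  apply dio_subst2. exact (dio_ren (fun x => match x with None => true | _ => false end) _
    (dio_var false)).
Qed.

Lemma dio_fun_of2 (f : nat -> nat -> nat) :
  Dio (fun r : nat -> nat => r 0 = f (r 1) (r 2)) ->
  forall (V : Set) (e1 e2 : (V -> nat) -> nat),
  DioFun e1 -> DioFun e2 -> DioFun (fun r => f (e1 r) (e2 r)).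
Proof.
  intros H V e1 e2 H1 H2. unfold DioFun.
  apply (dio_subst3 (fun x y z => x = f y z) (fun r : option V -> nat => r None)
    (fun r => e1 (fun v => r (Some v))) (fun r => e2 (fun v => r (Some v)))).
  - exact H.
  - apply dio_var.
  - exact (dio_ren lift _ H1).
  - exact (dio_ren lift _ H2).
Qed.

Lemma dio_add {V : Set} (e1 e2 : (V -> nat) -> nat) :
  DioFun e1 -> DioFun e2 -> DioFun (fun r => e1 r + e2 r).
Proof.
  apply dio_fun_of2.
  apply dio_iff with (R' := fun r : nat -> nat => r 1 + r 2 = r 0); [lia|].
  exact (dio_atom (Add 1 2 0)).
Qed.

Lemma dio_square {V : Set} (e : (V -> nat) -> nat) :
  DioFun e -> DioFun (fun r => e r * e r).
Proof.
  intros H.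
  apply (dio_fun_of2 (fun x y => x * x)) with (e1 := e) (e2 := e); auto.
  apply dio_iff with (R' := fun r : nat -> nat => r 1 * r 1 = r 0); [lia|].
  exact (dio_atom (Sq 1 0)).
Qed.

Lemma dio_mul {V : Set} (e1 e2 : (V -> nat) -> nat) :
  DioFun e1 -> DioFun e2 -> DioFun (fun r => e1 r * e2 r).
Proof.
  apply dio_fun_of2.
  (* Polarisation: [(x + y)^2 = x^2 + y^2 + 2 x y]. *)
  apply dio_iff with (R' := fun r : nat -> nat =>
    r 1 * r 1 + r 2 * r 2 + (r 0 + r 0) = (r 1 + r 2) * (r 1 + r 2)); [lia|].
  apply dio_eq; repeat first [apply dio_add | apply dio_square | apply dio_var].
Qed.

Lemma dio_succ {V : Set} (e : (V -> nat) -> nat) :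
  DioFun e -> DioFun (fun r => S (e r)).
Proof.
  intros H. exact (dio_add _ _ (dio_const 1) H).
Qed.

Lemma dio_le {V : Set} (e1 e2 : (V -> nat) -> nat) :
  DioFun e1 -> DioFun e2 -> Dio (fun r => e1 r <= e2 r).
Proof.
  apply dio_subst2.
  apply dio_iff with (R' := fun r : bool -> nat => exists d, r true + d = r false).
  - intros r. split; [intros H; exists (r false - r true); lia|intros [d H]; lia].
  - apply dio_ex, dio_eq; repeat first [apply dio_add | apply dio_var].
Qed.

Lemma dio_lt {V : Set} (e1 e2 : (V -> nat) -> nat) :
  DioFun e1 -> DioFun e2 -> Dio (fun r => e1 r < e2 r).
Proof.
  intros H1 H2. exact (dio_le _ _ (dio_succ _ H1) H2).
Qed.

(** The bound is a fixed number, not a variable, so this is a finite conjunction. *)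
Lemma dio_all {V : Set} (n : nat) (R : nat -> (V -> nat) -> Prop) :
  (forall i, Dio (R i)) -> Dio (fun r => forall i, i < n -> R i r).
Proof.
  intros H. induction n as [|n IH].
  - apply dio_iff with (R' := fun _ => True); [|apply dio_true].
    intros r. split; [easy|]. intros _ i Hi. lia.
  - apply dio_iff with (R' := fun r => (forall i, i < n -> R i r) /\ R n r).
    + intros r. split.
      * intros E. split; [intros i Hi|]; apply E; lia.
      * intros [E1 E2] i Hi. destruct (Nat.eq_dec i n) as [->|]; [exact E2|apply E1; lia].
    + now apply dio_and.
Qed.

Lemma dio_imp {V : Set} (P : Prop) (R : (V -> nat) -> Prop) :
  {P} + {~ P} -> Dio R -> Dio (fun r => P -> R r).
Proof.
  intros [H|H] HR; [apply dio_iff with (R' := R)|apply dio_iff with (R' := fun _ => True)];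
    try tauto. apply dio_true.
Qed.

Fixpoint sum (n : nat) (f : nat -> nat) : nat :=
  match n with 0 => 0 | S n => f 0 + sum n (fun i => f (S i)) end.

Lemma dio_sum {V : Set} (n : nat) (f : nat -> (V -> nat) -> nat) :
  (forall i, DioFun (f i)) -> DioFun (fun r => sum n (fun i => f i r)).
Proof.
  revert f. induction n as [|n IH]; intros f H; cbn [sum].
  - apply dio_const.
  - apply dio_add; [apply H|]. apply (IH (fun i => f (S i))). auto.
Qed.

Ltac dio :=
  repeat lazymatch goal with
  | |- Dio (fun _ => _ /\ _) => apply dio_and
  | |- Dio (fun _ => exists x : nat, _) => apply dio_ex
  | |- Dio (fun _ => @eq nat _ _) => apply dio_eq
  | |- Dio (fun _ => _ <= _) => apply dio_le
  | |- Dio (fun _ => _ < _) => apply dio_lt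
  | |- DioFun (fun r => r _) => apply dio_var
  | |- DioFun (fun r => _ + _) => apply dio_add
  | |- DioFun (fun r => _ * _) => apply dio_mul
  | |- DioFun (fun r => S _) => first [apply dio_const | apply dio_succ]
  | |- DioFun (fun r => _) => apply dio_const
  end.

(** * Pell equations *)

Section Pell.
Local Open Scope Z_scope.

(** The Lucas sequence of [X^2 - b X + 1]; its consecutive terms solve the Pell equation
    [x^2 - b x y + y^2 = 1]. *)
Fixpoint pell (b : Z) (n : nat) : Z :=
  match n with
  | O => 0
  | S m => match m with O => 1 | S k => b * pell b m - pell b k end
  end.

Lemma pell_0 b : pell b 0 = 0.
Proof. reflexivity. Qed.

Lemma pell_1 b : pell b 1 = 1.
Proof. reflexivity. Qed.

Lemma pell_SS b n : pell b (S (S n)) = b * pell b (S n) - pell b n.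
Proof. reflexivity. Qed.

Lemma recurrence_unique (b : Z) (f g : nat -> Z) :
  (forall n, f (S (S n)) = b * f (S n) - f n) ->
  (forall n, g (S (S n)) = b * g (S n) - g n) ->
  f O = g O -> f 1%nat = g 1%nat -> forall n, f n = g n.
Proof.
  intros Hf Hg H0 H1 n.
  enough (f n = g n /\ f (S n) = g (S n)) by tauto.
  induction n as [|n [IH1 IH2]]; [auto|].
  split; [exact IH2|]. rewrite Hf, Hg. congruence.
Qed.

Lemma pell_eq b n :
  pell b (S n) * pell b (S n) - b * pell b (S n) * pell b n + pell b n * pell b n = 1.
Proof.
  induction n as [|n IH]; [rewrite pell_0, pell_1; ring|].
  rewrite pell_SS, <- IH. ring.
Qed.

(** The factor [pell b (S n) - b * pell b n] is minus the term of index [n - 1], written so that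
    [n = 0] is no exception. *)
Lemma pell_add b m n :
  pell b (m + n) = pell b m * (pell b (S n) - b * pell b n) + pell b (S m) * pell b n.
Proof.
  revert m. apply (recurrence_unique b).
  - intros k. apply pell_SS.
  - intros k. rewrite !pell_SS. ring.
  - rewrite Nat.add_0_l, pell_0, pell_1. ring.
  - rewrite Nat.add_1_l, (pell_SS b 0), pell_0, pell_1. ring.
Qed.

(** The factor is the companion term [a^m + a^-m], with [a] a root of [X^2 - b X + 1]. Modulo it,
    shifting the index by [2 m] reverses the sign. *)
Lemma pell_double_add b m n :
  pell b (m + m + n) + pell b n
  = (2 * pell b (S m) - b * pell b m) * pell b (m + n).
Proof.
  revert n. apply (recurrence_unique b).
  - intros k. rewrite !Nat.add_succ_r, !pell_SS. ring.
  - intros k. rewrite !Nat.add_succ_r, !pell_SS. ring.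
  - rewrite !Nat.add_0_r, pell_add, pell_0. ring.
  - rewrite !Nat.add_1_r, <- Nat.add_succ_r, pell_add, pell_SS, pell_1.
    pose proof (pell_eq b m). nia.
Qed.

(** A reflection: with [m = i + d], the terms of indices [2 m - d] and [d] agree modulo the
    companion term of index [m]. *)
Lemma pell_double_sub b i d :
  pell b (i + i + d)
  = pell b d + (2 * pell b (S (i + d)) - b * pell b (i + d)) * pell b i.
Proof.
  revert d. apply (recurrence_unique b).
  - intros k. rewrite !Nat.add_succ_r, !pell_SS. ring.
  - intros k. rewrite !Nat.add_succ_r, !pell_SS. ring.
  - rewrite !Nat.add_0_r, pell_add, pell_0. ring.
  - rewrite !Nat.add_1_r, <- Nat.add_succ_r, pell_add, !pell_SS, pell_1.
    pose proof (pell_eq b i). nia.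
Qed.

Lemma pell_mod b c n : (b - c | pell b n - pell c n).
Proof.
  enough ((b - c | pell b n - pell c n) /\ (b - c | pell b (S n) - pell c (S n))) by tauto.
  induction n as [|n [[p IH1] [q IH2]]].
  - split; exists 0; reflexivity.
  - split; [now exists q|]. rewrite !pell_SS.
    exists (pell b (S n) + c * q - p). nia.
Qed.

Lemma pell_2 n : pell 2 n = Z.of_nat n.
Proof.
  revert n. apply (recurrence_unique 2); intros; rewrite ?pell_SS; cbn [pell]; lia.
Qed.

(** For the parameter 2 each term equals its index, so residues modulo [b - 2] reveal the index. *)
Lemma pell_mod_index b n : (b - 2 | pell b n - Z.of_nat n).
Proof. rewrite <- pell_2. apply pell_mod. Qed.

Section Growth.
Variable b : Z.
Hypothesis Hb : 2 <= b.

Lemma pell_bounds n : 0 <= pell b n < pell b (S n).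
Proof.
  induction n as [|n IH]; [cbn; lia|].
  rewrite pell_SS. nia.
Qed.

Lemma pell_lt i j : (i < j)%nat -> pell b i < pell b j.
Proof.
  induction 1 as [|j _ IH]; [apply pell_bounds|].
  pose proof (pell_bounds j). lia.
Qed.

Lemma pell_le i j : (i <= j)%nat -> pell b i <= pell b j.
Proof.
  intros H. destruct (Nat.eq_dec i j) as [->|]; [lia|].
  apply Z.lt_le_incl, pell_lt. lia.
Qed.

Lemma index_le_pell n : Z.of_nat n <= pell b n.
Proof.
  induction n as [|n IH]; [cbn; lia|]. pose proof (pell_bounds n). lia.
Qed.

Lemma pell_growth n : (b - 1) ^ Z.of_nat n <= pell b (S n).
Proof.
  induction n as [|n IH]; [cbn; lia|].
  rewrite Nat2Z.inj_succ, Z.pow_succ_r by lia.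
  rewrite pell_SS. pose proof (pell_bounds n). nia.
Qed.

(* Descent: (x, y) comes from the smaller solution (b x - y, x). *)
Lemma pell_complete x y : 0 <= x < y -> x * x - b * x * y + y * y = 1 ->
  exists n, x = pell b n /\ y = pell b (S n).
Proof.
  intros Hx. assert (H0 : 0 <= x) by lia. revert y Hx.
  revert x H0. apply (Zlt_0_ind (fun x => forall y, 0 <= x < y -> _ -> _)).
  intros x IH _ y Hx E.
  destruct (Z.eq_dec x 0) as [->|Hne].
  - exists O. cbn. nia.
  - destruct (IH (b * x - y)) with (y := x) as [n [E1 E2]].
    + nia.
    + nia.
    + nia.
    + exists (S n). rewrite pell_SS, <- E1, <- E2. lia.
Qed.

Lemma pell_coprime n : rel_prime (pell b n) (pell b (S n)).
Proof.
  apply bezout_rel_prime.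
  apply (Bezout_intro _ _ _ (pell b n - b * pell b (S n)) (pell b (S n))).
  rewrite <- (pell_eq b n). ring.
Qed.

(** Induction on [l] by the addition law. The second part is the congruence of [pell b (k * l)] with
    [l * pell b k * pell b (S k) ^ (l - 1)] modulo the square of [pell b k], divided by [pell b k]
    and multiplied by [pell b (S k)] to avoid the exponent [l - 1]. *)
Lemma pell_mul_index k l :
  (pell b k | pell b (k * l + 1) - pell b (S k) ^ Z.of_nat l) /\
  exists t, pell b (k * l) = pell b k * t /\
    (pell b k | pell b (S k) * t - Z.of_nat l * pell b (S k) ^ Z.of_nat l).
Proof.
  induction l as [|l [[p IH1] [t [IH2 [q IH3]]]]].
  - rewrite Nat.mul_0_r. split; [now exists 0|].
    exists 0. split; [rewrite pell_0; ring|]. exists 0. ring.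
  - rewrite Nat2Z.inj_succ, Z.pow_succ_r, Nat.mul_succ_r by lia.
    set (U := pell b k) in *. set (V := pell b (S k)) in *.
    set (W := V ^ Z.of_nat l) in *.
    rewrite Nat.add_1_r in IH1.
    split.
    + replace (k * l + k + 1)%nat with (k * l + S k)%nat by lia.
      rewrite pell_add, pell_SS, IH2. fold U V.
      exists (p * V - t * U).
      replace (pell b (S (k * l))) with (p * U + W) by lia. ring.
    + exists (t * (V - b * U) + pell b (S (k * l))). split.
      * rewrite pell_add, IH2. fold U V. ring.
      * exists (q * V + p * V - b * t * V).
        replace (pell b (S (k * l))) with (p * U + W) by lia.
        transitivity (V * (V * t) - b * V * U * t + V * p * U + V * W - (Z.of_nat l + 1) * (V * W));
          [unfold Z.succ; ring|].
        replace (V * t) with (q * U + Z.of_nat l * W) by lia.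
        transitivity (V * (q * U + Z.of_nat l * W) - b * U * (V * t) + V * p * U + V * W - (Z.of_nat l + 1) * (V * W)); [ring|].
        ring.
Qed.

Lemma rel_prime_pow_l a c n : rel_prime a c -> rel_prime a (c ^ Z.of_nat n).
Proof.
  intros H. induction n as [|n IH].
  - apply rel_prime_sym, rel_prime_1.
  - rewrite Nat2Z.inj_succ, Z.pow_succ_r by lia. now apply rel_prime_mult.
Qed.

(** With [r] the remainder of [m] modulo [k], the addition law and coprimality give
    [pell b k | pell b r]; monotonicity then forces [r = 0]. *)
Lemma pell_divide_index k m : (0 < k)%nat -> (pell b k | pell b m) ->
  exists l, m = (k * l)%nat.
Proof.
  intros Hk H.
  exists (m / k)%nat.
  pose proof (Nat.div_mod_eq m k) as E. pose proof (Nat.mod_upper_bound m k) as Hr.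
  set (l := (m / k)%nat) in *. set (r := (m mod k)%nat) in *.
  destruct (pell_mul_index k l) as [[p E1] [t [E2 _]]].
  rewrite E, pell_add, E2 in H. rewrite Nat.add_1_r in E1.
  assert (H' : (pell b k | pell b (S k) ^ Z.of_nat l * pell b r)).
  { replace (pell b (S k) ^ Z.of_nat l) with (pell b (S (k * l)) - p * pell b k) by lia.
    rewrite Z.mul_sub_distr_r. apply Z.divide_sub_r.
    - apply Z.divide_add_cancel_r with (2 := H). apply Z.divide_mul_l, Z.divide_factor_l.
    - apply Z.divide_mul_l, Z.divide_factor_r. }
  apply Gauss in H'; [|apply rel_prime_pow_l, pell_coprime].
  destruct (Nat.eq_dec r 0); [lia|exfalso].
  apply Z.divide_pos_le in H'.
  - pose proof (pell_lt r k). lia.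
  - pose proof (pell_lt 0 r). cbn in *. lia.
Qed.

(** Modulo [pell b k], the quotient [t] of the two terms is [l] up to powers of [pell b (S k)],
    which is invertible. *)
Lemma pell_square_divide k l : (0 < k)%nat ->
  (pell b k * pell b k | pell b (k * l)) <-> (pell b k | Z.of_nat l).
Proof.
  intros Hk. destruct (pell_mul_index k l) as [_ [t [-> H]]].
  assert (Hp : 0 < pell b k) by (apply (pell_lt 0 k Hk)).
  assert (Hc := pell_coprime k).
  split; intros H'.
  - apply Z.mul_divide_cancel_l in H'; [|lia].
    apply Gauss with (b := pell b (S k) ^ Z.of_nat l); [|apply rel_prime_pow_l, Hc].
    rewrite Z.mul_comm.
    replace (Z.of_nat l * pell b (S k) ^ Z.of_nat l) with (pell b (S k) * t -
      (pell b (S k) * t - Z.of_nat l * pell b (S k) ^ Z.of_nat l)) by ring.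
    apply Z.divide_sub_r; [now apply Z.divide_mul_r|exact H].
  - apply Z.mul_divide_mono_l.
    apply Gauss with (b := pell b (S k)); [|exact Hc].
    replace (pell b (S k) * t) with (pell b (S k) * t
      - Z.of_nat l * pell b (S k) ^ Z.of_nat l + Z.of_nat l * pell b (S k) ^ Z.of_nat l) by ring.
    apply Z.divide_add_r; [exact H|now apply Z.divide_mul_l].
Qed.

(* Signs are independent: [n] folds to [j <= m] by reflections at multiples of [m]. *)
Lemma pell_fold m n : (0 < m)%nat ->
  let v := 2 * pell b (S m) - b * pell b m in
  exists j, (j <= m)%nat /\
  ((v | pell b n - pell b j) \/ (v | pell b n + pell b j)) /\
  ((2 * Z.of_nat m | Z.of_nat n - Z.of_nat j) \/ (2 * Z.of_nat m | Z.of_nat n + Z.of_nat j)).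
Proof.
  intros Hm v. induction n as [n IH] using lt_wf_ind.
  destruct (le_lt_dec n m) as [H|H].
  - exists n. split; [exact H|]. split; left; exists 0; lia.
  - destruct (le_lt_dec (m + m) n) as [H'|H'].
    (* The shift by [2 m] flips the sign of the value and keeps that of the index; the reflection in
       the other case does the reverse. *)
    + destruct (IH (n - (m + m))%nat) as [j [Hj [Ha Hn]]]; [lia|].
      exists j. split; [exact Hj|].
      pose proof (pell_double_add b m (n - (m + m))) as E.
      replace (m + m + (n - (m + m)))%nat with n in E by lia. fold v in E.
      set (x := pell b (n - (m + m))) in *. set (y := pell b (m + (n - (m + m)))) in *.
      split.
      * destruct Ha as [[p Ha]|[p Ha]]; [right; exists (y - p)|left; exists (y - p)]; lia.
      * rewrite Nat2Z.inj_sub in Hn by lia.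
        destruct Hn as [[p Hn]|[p Hn]]; [left; exists (p + 1)|right; exists (p + 1)]; lia.
    + exists (m + m - n)%nat. split; [lia|].
      pose proof (pell_double_sub b (n - m) (m + m - n)) as E.
      replace (n - m + (n - m) + (m + m - n))%nat with n in E by lia.
      replace (n - m + (m + m - n))%nat with m in E by lia. fold v in E.
      split; [left|right].
      * exists (pell b (n - m)). lia.
      * exists 1. lia.
Qed.

End Growth.

(** * Recovering value and index of a Pell term from residues up to sign *)

Definition congr_pm (v x a : Z) : Prop := (v | x - a) \/ (v | x + a).

Lemma congr_pm_unique v x p q : 0 <= 2 * p < v -> 0 <= 2 * q < v ->
  congr_pm v x p -> congr_pm v x q -> p = q.
Proof.
  intros Hp Hq H1 H2.
  assert (H : (v | p - q) \/ (v | p + q)).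
  { destruct H1 as [[k H1]|[k H1]], H2 as [[l H2]|[l H2]].
    - left; exists (l - k); lia.
    - right; exists (l - k); lia.
    - right; exists (k - l); lia.
    - left; exists (k - l); lia. }
  destruct H as [[k H]|[k H]]; assert (k = 0) by nia; subst k; lia.
Qed.

Lemma congr_pm_trans v x y a : (v | x - y) -> congr_pm v y a -> congr_pm v x a.
Proof.
  intros [k H] [[l H']|[l H']]; [left|right]; exists (k + l); lia.
Qed.

Lemma congr_pm_dvd u v x a : (u | v) -> congr_pm v x a -> congr_pm u x a.
Proof.
  intros H [H'|H']; [left|right]; now apply Z.divide_trans with v.
Qed.

(* With [u = pell b k], [s = pell b m], [x = pell w n]: divisibility of [s] by [u^2] forces
   [u | m]; the residue of [x] modulo [b s - 2 r] determines the folded index [j] of [n]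
   modulo [2 m], hence modulo [u], while [x = n] modulo [u]. *)
Lemma pell_system_sound (b u t r s w x y a : Z) (c : nat) :
  4 <= b -> 0 <= t < u -> t * t - b * t * u + u * u = 1 ->
  0 <= r < s -> r * r - b * r * s + s * s = 1 -> (u * u | s) ->
  2 <= w -> (b * s - 2 * r | w - b) -> (u | w - 2) ->
  0 <= x < y -> x * x - w * x * y + y * y = 1 ->
  0 <= 2 * a < u -> 2 * a < b * s - 2 * r -> 2 * Z.of_nat c < u ->
  congr_pm (b * s - 2 * r) x a -> congr_pm u x (Z.of_nat c) ->
  a = pell b c.
Proof.
  intros Hb Ht Et Hr Er Hs Hw Hwb Hwu Hx Ex Ha Hav Hc Hxa Hxc.
  destruct (pell_complete b ltac:(lia) t u Ht Et) as [k [-> ->]].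
  destruct (pell_complete b ltac:(lia) r s Hr Er) as [m [-> ->]].
  destruct (pell_complete w ltac:(lia) x y Hx Ex) as [n [-> ->]].
  destruct (pell_divide_index b ltac:(lia) (S k) (S m)) as [l El]; [lia| |].
  { apply Z.divide_trans with (2 := Hs). apply Z.divide_factor_l. }
  assert (Hum : (pell b (S k) | Z.of_nat (S m))).
  { rewrite El in Hs. apply pell_square_divide in Hs; [|lia|lia].
    rewrite El, Nat2Z.inj_mul. now apply Z.divide_mul_r. }
  destruct (pell_fold b (S m) n) as [j [Hj [Hv Hn]]]; [lia|].
  (* The companion term of index [S m], expressed by [r] and [s] alone. *)
  set (v := b * pell b (S m) - 2 * pell b m) in *.
  replace (2 * pell b (S (S m)) - b * pell b (S m)) with v in Hv
    by (unfold v; rewrite pell_SS; ring).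
  pose proof (pell_bounds b ltac:(lia) m) as Bm.
  pose proof (pell_le b ltac:(lia) j (S m) Hj) as Bj.
  pose proof (pell_le b ltac:(lia) 0 j ltac:(lia)) as Bj0. rewrite pell_0 in Bj0.
  assert (Haj : a = pell b j).
  { apply (congr_pm_unique v (pell w n)); [lia| |exact Hxa|].
    - unfold v. nia.
    - apply congr_pm_trans with (y := pell b n); [|exact Hv].
      apply Z.divide_trans with (1 := Hwb). apply pell_mod. }
  rewrite Haj. f_equal. apply Nat2Z.inj.
  pose proof (index_le_pell b ltac:(lia) j).
  apply (congr_pm_unique (pell b (S k)) (pell w n)); [lia|lia| |exact Hxc].
  apply congr_pm_trans with (y := Z.of_nat n).
  - apply Z.divide_trans with (1 := Hwu), pell_mod_index.
  - apply congr_pm_dvd with (2 := Hn). now apply Z.divide_mul_r.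
Qed.

(** Parity repeats after 6 steps, for even and odd [b] alike. This yields odd terms of arbitrarily
    large index. *)
Lemma pell_odd b i : Z.odd (pell b (6 * i + 1)) = true.
Proof.
  assert (H : forall n, Z.odd (pell b (S (S n))) =
    xorb (Z.odd b && Z.odd (pell b (S n))) (Z.odd (pell b n))).
  { intros n. rewrite pell_SS, Z.odd_sub, Z.odd_mul. reflexivity. }
  assert (H6 : forall n, Z.odd (pell b (6 + n)) = Z.odd (pell b n)).
  { intros n. cbn [Nat.add]. rewrite !H.
    destruct (Z.odd b), (Z.odd (pell b (S n))), (Z.odd (pell b n)); reflexivity. }
  induction i as [|i IH]; [reflexivity|].
  replace (6 * S i + 1)%nat with (6 + (6 * i + 1))%nat by lia.
  now rewrite H6.
Qed.

Lemma pell_system_complete (b : Z) (c : nat) : 4 <= b ->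
  exists u t r s w x y : Z,
  0 <= t < u /\ t * t - b * t * u + u * u = 1 /\
  0 <= r < s /\ r * r - b * r * s + s * s = 1 /\ (u * u | s) /\
  2 <= w /\ b <= w /\ (b * s - 2 * r | w - b) /\ (u | w - 2) /\
  0 <= x < y /\ x * x - w * x * y + y * y = 1 /\
  2 * pell b c < u /\ 2 * pell b c < b * s - 2 * r /\ 2 * Z.of_nat c < u /\
  congr_pm (b * s - 2 * r) x (pell b c) /\ congr_pm u x (Z.of_nat c).
Proof.
  intros Hb. assert (Hb2 : 2 <= b) by lia.
  set (a := pell b c).
  assert (Hca := index_le_pell b Hb2 c). fold a in Hca.
  (* The multiple of 6 makes [u] odd; its size makes [u] exceed [2 * a] and [2 * c]. *)
  set (k := (6 * (Z.to_nat a + 1))%nat).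
  set (u := pell b (S k)).
  assert (Hk := index_le_pell b Hb2 (S k)). fold u in Hk.
  set (m := (k * Z.to_nat u + Z.to_nat u - 1)%nat).
  assert (Hm : S m = (S k * Z.to_nat u)%nat) by lia.
  set (r := pell b m). set (s := pell b (S m)).
  assert (Hs : (u * u | s)).
  { unfold s, u at 1 2. rewrite Hm. apply pell_square_divide; [lia|lia|].
    rewrite Z2Nat.id by lia. apply Z.divide_refl. }
  assert (Hrs : 0 <= r < s) by (apply pell_bounds; lia).
  assert (Hus : u <= s).
  { apply pell_le; [lia|]. rewrite Hm. assert (1 <= Z.to_nat u)%nat by lia. nia. }
  set (v := b * s - 2 * r).
  assert (Hv : 2 * s < v) by (unfold v; nia).
  (* Since [u] divides [s], only [2 * r] matters, and [u] is odd and prime to [r]. *)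
  assert (Huv : rel_prime u v).
  { assert (H2 : rel_prime u 2).
    { apply rel_prime_sym, prime_rel_prime; [apply prime_2|].
      intros [q Hq]. pose proof (pell_odd b (Z.to_nat a + 1)) as Ho.
      fold k in Ho. rewrite Nat.add_1_r in Ho. fold u in Ho. rewrite Hq in Ho.
      rewrite Z.odd_mul, Bool.andb_false_r in Ho. discriminate. }
    assert (Hr : rel_prime u r).
    { apply rel_prime_div with (p := s).
      - apply rel_prime_sym, pell_coprime; lia.
      - apply Z.divide_trans with (2 := Hs), Z.divide_factor_l. }
    pose proof (rel_prime_mult _ _ _ H2 Hr) as H.
    apply rel_prime_bezout in H. destruct H as [p q E].
    destruct Hs as [h Hs].
    apply bezout_rel_prime. apply (Bezout_intro _ _ _ (p + q * b * h * u) (- q)).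
    rewrite <- E. unfold v. rewrite Hs. ring. }
  assert (Hw : exists w, b <= w /\ (v | w - b) /\ (u | w - 2)).
  { apply rel_prime_bezout in Huv. destruct Huv as [p q E].
    (* Chinese remainders: [q * v] is 1 modulo [u], so the first correction changes the residue from
       [b] to 2; the multiple of [u * v] keeps the sum at least [b]. *)
    exists (b + v * (q * (2 - b) + u * (Z.abs (q * (2 - b))))).
    assert (Hz : 0 <= q * (2 - b) + u * Z.abs (q * (2 - b))).
    { generalize (q * (2 - b)). intros z. assert (1 <= u) by lia.
      destruct (Z.abs_spec z) as [[? ->]|[? ->]]; nia. }
    split; [nia|]. split.
    - exists (q * (2 - b) + u * Z.abs (q * (2 - b))). ring.
    - exists (v * Z.abs (q * (2 - b)) - p * (2 - b)).
      transitivity (b - 2 + (q * v) * (2 - b) + v * u * Z.abs (q * (2 - b))); [ring|].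
      replace (q * v) with (1 - p * u) by lia. ring. }
  destruct Hw as [w [Hw [Hwb Hwu]]].
  exists u, (pell b k), r, s, w, (pell w c), (pell w (S c)).
  assert (E1 := pell_eq b k). fold u in E1. assert (E2 := pell_eq b m). fold r s in E2.
  assert (E3 := pell_eq w c).
  assert (Hbu := pell_bounds b Hb2 k). fold u in Hbu.
  assert (Hbw := pell_bounds w ltac:(lia) c).
  fold v. repeat match goal with |- _ /\ _ => split end; try lia; try assumption.
  - left. apply Z.divide_trans with (1 := Hwb), pell_mod.
  - left. apply Z.divide_trans with (1 := Hwu), pell_mod_index.
Qed.

End Pell.

(** * Exponentiation *)

Lemma dio_or_eq {V : Set} (a b c d : (V -> nat) -> nat) :
  DioFun a -> DioFun b -> DioFun c -> DioFun d ->
  Dio (fun r => a r = b r \/ c r = d r).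
Proof.
  intros Ha Hb Hc Hd.
  (* This is [(a - b) * (c - d) = 0] with the negative terms moved across. *)
  apply dio_iff with (R' := fun r => a r * c r + b r * d r = a r * d r + b r * c r).
  - intros r. split; [intros [-> | ->]; lia|]. intros H.
    destruct (Nat.eq_dec (a r) (b r)); [now left|right].
    apply Nat2Z.inj. assert (H' : ((Z.of_nat (a r) - Z.of_nat (b r)) * (Z.of_nat (c r) - Z.of_nat (d r)) = 0)%Z)
      by lia.
    apply Z.mul_eq_0 in H'. lia.
  - dio; assumption.
Qed.

Definition ncongr (v x a : nat) : Prop :=
  exists p q, x + v * p = a + v * q \/ x + a = v * q.

Lemma ncongr_Z v x a :
  ncongr v x a <-> congr_pm (Z.of_nat v) (Z.of_nat x) (Z.of_nat a).
Proof.
  split.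
  - intros [p [q [H|H]]]; [left; exists (Z.of_nat q - Z.of_nat p)%Z|right; exists (Z.of_nat q)]; nia.
  - intros [[k H]|[k H]].
    + exists (Z.to_nat (- k)), (Z.to_nat k). left. nia.
    + exists 0, (Z.to_nat k). right. nia.
Qed.

Definition pn (b n : nat) : nat := Z.to_nat (pell (Z.of_nat b) n).

Lemma pn_Z b n : 2 <= b -> Z.of_nat (pn b n) = pell (Z.of_nat b) n.
Proof.
  intros H. unfold pn. apply Z2Nat.id. apply pell_bounds. lia.
Qed.

(** The conditions of [pell_system_sound] without subtraction; [h], [k] and [l] are the quotients of
    its three divisibilities. *)
Definition pell_system (a b c u t r s w x y v h k l : nat) : Prop :=
  4 <= b /\ t < u /\ t * t + u * u = b * t * u + 1 /\
  r < s /\ r * r + s * s = b * r * s + 1 /\ s = u * u * h /\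
  v + 2 * r = b * s /\ w = b + v * k /\ w = 2 + u * l /\
  x < y /\ x * x + y * y = w * x * y + 1 /\
  2 * a < u /\ 2 * a < v /\ 2 * c < u /\ ncongr v x a /\ ncongr u x c.

Lemma pell_system_iff a b c :
  (4 <= b /\ a = pn b c) <->
  exists u t r s w x y v h k l, pell_system a b c u t r s w x y v h k l.
Proof.
  split.
  - intros [Hb ->].
    destruct (pell_system_complete (Z.of_nat b) c ltac:(lia)) as
      (u & t & r & s & w & x & y & H1 & H2 & H3 & H4 & [h Hh] & H6 & H7 & [k Hk] & [l Hl]
       & Hx & Hxy & Hu & Hv & Hc & Ca & Cc).
    rewrite <- pn_Z in * by lia.
    exists (Z.to_nat u), (Z.to_nat t), (Z.to_nat r), (Z.to_nat s), (Z.to_nat w),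
      (Z.to_nat x), (Z.to_nat y), (Z.to_nat (Z.of_nat b * s - 2 * r)),
      (Z.to_nat h), (Z.to_nat k), (Z.to_nat l).
    set (v := (Z.of_nat b * s - 2 * r)%Z) in *.
    assert (0 <= h)%Z by nia. assert (0 <= k)%Z by nia. assert (0 <= l)%Z by nia.
    unfold pell_system. rewrite !ncongr_Z, !Z2Nat.id by lia.
    repeat match goal with |- _ /\ _ => split end; try lia; try assumption;
      apply Nat2Z.inj; rewrite ?Nat2Z.inj_add, ?Nat2Z.inj_mul, ?Z2Nat.id by lia; lia.
  - intros (u & t & r & s & w & x & y & v & h & k & l & Hb & Ht & Et & Hr & Er & Hs & Hv
      & Hwb & Hwu & Hx & Ex & Hau & Hav & Hcu & Ca & Cc).
    split; [exact Hb|]. apply Nat2Z.inj. rewrite pn_Z by lia.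
    rewrite ncongr_Z in Ca, Cc.
    replace (Z.of_nat v) with (Z.of_nat b * Z.of_nat s - 2 * Z.of_nat r)%Z in Ca by lia.
    apply (pell_system_sound (Z.of_nat b) (Z.of_nat u) (Z.of_nat t) (Z.of_nat r) (Z.of_nat s)
      (Z.of_nat w) (Z.of_nat x) (Z.of_nat y)); try lia; try assumption.
    + exists (Z.of_nat h). lia.
    + exists (Z.of_nat k). lia.
    + exists (Z.of_nat l). lia.
Qed.

Lemma dio_ncongr {V : Set} (e1 e2 e3 : (V -> nat) -> nat) :
  DioFun e1 -> DioFun e2 -> DioFun e3 -> Dio (fun r => ncongr (e1 r) (e2 r) (e3 r)).
Proof.
  apply dio_subst3. unfold ncongr. dio. apply dio_or_eq; dio.
Qed.

Lemma dio_pn {V : Set} (e1 e2 e3 : (V -> nat) -> nat) :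
  DioFun e1 -> DioFun e2 -> DioFun e3 -> Dio (fun r => 4 <= e2 r /\ e1 r = pn (e2 r) (e3 r)).
Proof.
  apply (dio_subst3 (fun a b c => 4 <= b /\ a = pn b c)).
  eapply dio_iff; [intros r; apply pell_system_iff|].
  unfold pell_system. dio; apply dio_ncongr; dio.
Qed.

(* Modulo [q b - q^2 - 1], [q] is a root of the characteristic polynomial [X^2 - b X + 1]. *)
Lemma pell_pow (q b : Z) (n : nat) :
  (q * b - q * q - 1 | q ^ Z.of_nat n - (pell b (S n) - (b - q) * pell b n))%Z.
Proof.
  induction n as [|n [k IH]].
  - exists 0%Z. rewrite pell_0, pell_1, Z.pow_0_r. ring.
  - exists (q * k - pell b n)%Z.
    rewrite Nat2Z.inj_succ, Z.pow_succ_r, pell_SS by lia.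
    transitivity (q * (k * (q * b - q * q - 1)) - pell b n * (q * b - q * q - 1))%Z; [|ring].
    rewrite <- IH. ring.
Qed.

(** Describes [z = (q + 1)^n]. The last equation is the congruence [pell_pow] modulo [m]. The term
    [A] grows at least like the power, so choosing [b] above [A] makes [m] exceed it; the summand 4
    meets the lower bound in the definition of [pn]. *)
Definition pow_system (z q n A b A1 A2 m g h : nat) : Prop :=
  (4 <= q + 4 /\ A = pn (q + 4) (S n)) /\ b = A + q + 4 /\
  (4 <= b /\ A1 = pn b n) /\ (4 <= b /\ A2 = pn b (S n)) /\
  m + (q + 1) * (q + 1) + 1 = (q + 1) * b /\ z < m /\
  z + b * A1 + m * g = A2 + (q + 1) * A1 + m * h.

Lemma pow_system_iff z q n :
  z = S q ^ n <-> exists A b A1 A2 m g h, pow_system z q n A b A1 A2 m g h.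
Proof.
  assert (Hmod : forall A b A1 A2 m : nat, A = pn (q + 4) (S n) -> b = A + q + 4 ->
    A1 = pn b n -> A2 = pn b (S n) -> m + (q + 1) * (q + 1) + 1 = (q + 1) * b ->
    S q ^ n < m /\ (Z.of_nat m | Z.of_nat (S q ^ n) -
       (Z.of_nat A2 - (Z.of_nat b - Z.of_nat (S q)) * Z.of_nat A1))%Z).
  { intros A b A1 A2 m HA Hb H1 H2 Hm. split.
    - assert (HG : S q ^ n <= A).
      { pose proof (pell_growth (Z.of_nat (q + 4)) ltac:(lia) n) as G.
        rewrite <- pn_Z, <- HA in G by lia.
        apply Nat2Z.inj_le. rewrite Nat2Z.inj_pow.
        apply Z.le_trans with (2 := G). apply Z.pow_le_mono_l. lia. }
      subst b. nia.
    - subst A1 A2. rewrite !pn_Z by lia. rewrite Nat2Z.inj_pow.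
      replace (Z.of_nat m) with (Z.of_nat (S q) * Z.of_nat b - Z.of_nat (S q) * Z.of_nat (S q) - 1)%Z by lia.
      apply pell_pow. }
  split.
  - intros ->.
    set (A := pn (q + 4) (S n)). set (b := A + q + 4).
    set (m := (q + 1) * b - (q + 1) * (q + 1) - 1).
    assert (Hm : m + (q + 1) * (q + 1) + 1 = (q + 1) * b).
    { unfold m. enough ((q + 1) * (q + 1) + 1 <= (q + 1) * b) by lia. unfold b. nia. }
    destruct (Hmod A b _ _ m eq_refl eq_refl eq_refl eq_refl Hm) as [Hlt [k Hk]].
    exists A, b, (pn b n), (pn b (S n)), m, (Z.to_nat (- k)), (Z.to_nat k).
    unfold pow_system. repeat match goal with |- _ /\ _ => split end; try lia; try reflexivity.
  - intros (A & b & A1 & A2 & m & g & h & [_ HA] & Hb & [_ H1] & [_ H2] & Hm & Hz & E).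
    destruct (Hmod A b A1 A2 m HA Hb H1 H2 Hm) as [Hlt [k Hk]].
    assert (Hd : (Z.of_nat z - Z.of_nat (S q ^ n) = (Z.of_nat h - Z.of_nat g - k) * Z.of_nat m)%Z) by lia.
    assert ((Z.of_nat h - Z.of_nat g - k = 0)%Z) by nia. lia.
Qed.

Lemma dio_pow_succ {V : Set} (e1 e2 : (V -> nat) -> nat) :
  DioFun e1 -> DioFun e2 -> DioFun (fun r => S (e1 r) ^ e2 r).
Proof.
  apply (dio_fun_of2 (fun x y => S x ^ y)).
  eapply dio_iff; [intros r; apply pow_system_iff|].
  unfold pow_system.
  do 7 apply dio_ex. apply dio_and; [apply (dio_pn (fun r => r _) (fun r => _) (fun r => _)); dio|].
  apply dio_and; [dio|].
  apply dio_and; [apply (dio_pn (fun r => r _) (fun r => _) (fun r => _)); dio|].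
  apply dio_and; [apply (dio_pn (fun r => r _) (fun r => _) (fun r => _)); dio|].
  dio.
Qed.

(** * Binomial coefficients and the bitwise order *)

Fixpoint binom (n k : nat) : nat :=
  match k, n with
  | 0, _ => 1
  | S _, 0 => 0
  | S k', S n' => binom n' k' + binom n' k
  end.

Lemma binom_0 n : binom n 0 = 1.
Proof. now destruct n. Qed.

Lemma binom_SS n k : binom (S n) (S k) = binom n k + binom n (S k).
Proof. reflexivity. Qed.

Lemma binom_gt n k : n < k -> binom n k = 0.
Proof.
  revert k. induction n as [|n IH]; intros [|k] H; try lia; [reflexivity|].
  rewrite binom_SS, !IH; lia.
Qed.

Lemma binom_le n k : binom n k <= 2 ^ n.
Proof.
  revert k. induction n as [|n IH]; intros [|k]; [cbn; lia..| |].
  - rewrite binom_0. pose proof (Nat.pow_nonzero 2 (S n)). lia.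
  - rewrite binom_SS, Nat.pow_succ_r'. pose proof (IH k). pose proof (IH (S k)). lia.
Qed.

(* Lucas' theorem modulo 2. *)
Lemma binom_parity n k :
  Nat.odd (binom (2 * n) (2 * k)) = Nat.odd (binom n k) /\
  Nat.odd (binom (2 * n) (S (2 * k))) = false /\
  Nat.odd (binom (S (2 * n)) (2 * k)) = Nat.odd (binom n k) /\
  Nat.odd (binom (S (2 * n)) (S (2 * k))) = Nat.odd (binom n k).
Proof.
  assert (E : forall j, 2 * S j = S (S (2 * j))) by (intros; lia).
  (* Row [2 n + 1] of Pascal's triangle follows from row [2 n]; the induction below leads from there
     to row [2 n + 2]. *)
  assert (step : forall n,
    (forall k, Nat.odd (binom (2 * n) (2 * k)) = Nat.odd (binom n k) /\
       Nat.odd (binom (2 * n) (S (2 * k))) = false) ->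
    forall k, Nat.odd (binom (S (2 * n)) (2 * k)) = Nat.odd (binom n k) /\
       Nat.odd (binom (S (2 * n)) (S (2 * k))) = Nat.odd (binom n k)).
  { clear n k. intros n H k. split.
    - destruct k as [|j]; [now rewrite !binom_0|].
      rewrite E, binom_SS, Nat.odd_add, (proj2 (H j)), <- E, (proj1 (H (S j))).
      now destruct Nat.odd.
    - rewrite binom_SS, Nat.odd_add, (proj1 (H k)), (proj2 (H k)).
      now destruct Nat.odd. }
  enough (H : forall k, Nat.odd (binom (2 * n) (2 * k)) = Nat.odd (binom n k) /\
       Nat.odd (binom (2 * n) (S (2 * k))) = false).
  { pose proof (H k). pose proof (step n H k). tauto. }
  clear k. induction n as [|n IH]; intros k.
  - destruct k as [|j]; [split; reflexivity|]. rewrite E. split; reflexivity.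
  - pose proof (step n IH) as H. rewrite (E n). split.
    + destruct k as [|j]; [now rewrite !binom_0|].
      rewrite E, (binom_SS (S (2 * n))), Nat.odd_add, <- E, (proj2 (H j)), (proj1 (H (S j))).
      now rewrite binom_SS, Nat.odd_add.
    + rewrite (binom_SS (S (2 * n))), Nat.odd_add, (proj1 (H k)), (proj2 (H k)).
      now destruct Nat.odd.
Qed.

Definition mask (r s : nat) : Prop :=
  forall i, Nat.testbit r i = true -> Nat.testbit s i = true.

Lemma mask_0 s : mask 0 s.
Proof. intros i H. rewrite Nat.bits_0 in H. discriminate. Qed.

Lemma mask_0_r r : mask r 0 -> r = 0.
Proof.
  intros H. apply Nat.bits_inj_0. intros i. specialize (H i).
  rewrite Nat.bits_0 in H. destruct (Nat.testbit r i); [symmetry; auto|reflexivity].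
Qed.

Lemma mask_refl r : mask r r.
Proof. intros i. auto. Qed.

Lemma testbit_split p a x i : a < 2 ^ p ->
  Nat.testbit (a + 2 ^ p * x) i = if i <? p then Nat.testbit a i else Nat.testbit x (i - p).
Proof.
  intros H. destruct (Nat.ltb_spec i p) as [Hi|Hi].
  - rewrite <- (Nat.mod_pow2_bits_low _ _ _ Hi).
    rewrite Nat.mul_comm, Nat.Div0.mod_add, Nat.mod_small by lia. reflexivity.
  - replace i with (i - p + p) at 1 by lia.
    rewrite <- Nat.div_pow2_bits. f_equal.
    rewrite Nat.mul_comm, Nat.div_add, Nat.div_small by lia. reflexivity.
Qed.

Lemma mask_split p a b x y : a < 2 ^ p -> b < 2 ^ p ->
  mask (a + 2 ^ p * x) (b + 2 ^ p * y) <-> mask a b /\ mask x y.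
Proof.
  intros Ha Hb. split.
  - intros H. split; intros i.
    + specialize (H i). rewrite !testbit_split in H by assumption.
      destruct (Nat.ltb_spec i p); [exact H|].
      rewrite <- (Nat.mod_small _ _ Ha), Nat.mod_pow2_bits_high by lia. discriminate.
    + specialize (H (i + p)). rewrite !testbit_split in H by assumption.
      destruct (Nat.ltb_spec (i + p) p); [lia|]. now rewrite Nat.add_sub in H.
  - intros [H1 H2] i. rewrite !testbit_split by assumption.
    destruct (Nat.ltb_spec i p); auto.
Qed.

(** Lucas' theorem one bit at a time: dropping the last bits changes neither side, except for 1 over
    0, where both sides fail. *)
Lemma mask_iff_binom r s : mask r s <-> Nat.odd (binom s r) = true.
Proof.
  revert r. induction s as [s IH] using lt_wf_ind. intros r.
  destruct (Nat.eq_dec s 0) as [->|Hs].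
  - destruct r as [|r]; [split; [reflexivity|intros _; apply mask_0]|].
    split; [intros H; now apply mask_0_r in H|discriminate].
  - rewrite (Nat.div2_odd s), (Nat.div2_odd r).
    assert (Hlt : Nat.div2 s < s) by (apply Nat.lt_div2; lia).
    specialize (IH _ Hlt (Nat.div2 r)). revert IH.
    generalize (Nat.div2 s) as n, (Nat.div2 r) as k. intros n k IH.
    destruct (binom_parity n k) as [P1 [P2 [P3 P4]]].
    assert (M : forall a b : bool, mask (2 * k + Nat.b2n b) (2 * n + Nat.b2n a) <->
      mask (Nat.b2n b) (Nat.b2n a) /\ mask k n).
    { intros a b. rewrite !(Nat.add_comm (2 * _)).
      apply (mask_split 1); [destruct b|destruct a]; cbn; lia. }
    rewrite M, IH. clear M.
    destruct (Nat.odd s), (Nat.odd r); cbn [Nat.b2n];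
      rewrite ?Nat.add_0_r, ?Nat.add_1_r, ?P1, ?P2, ?P3, ?P4.
    + pose proof (mask_refl 1). tauto.
    + pose proof (mask_0 1). tauto.
    + split; [intros [H _]; now apply mask_0_r in H|discriminate].
    + pose proof (mask_0 0). tauto.
Qed.

Lemma mask_le r s : mask r s -> r <= s.
Proof.
  intros H. apply mask_iff_binom in H.
  destruct (le_lt_dec r s) as [|Hlt]; [assumption|].
  rewrite binom_gt in H by exact Hlt. discriminate.
Qed.

Lemma mask_ones p a : mask a (2 ^ p - 1) <-> a < 2 ^ p.
Proof.
  pose proof (Nat.pow_nonzero 2 p). split; intros H1.
  - apply mask_le in H1. lia.
  - intros i. replace (2 ^ p - 1) with (Nat.ones p) by (rewrite Nat.ones_equiv; lia).
    destruct (le_lt_dec p i) as [Hi|Hi].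
    + rewrite <- (Nat.mod_small _ _ H1), Nat.mod_pow2_bits_high by lia. discriminate.
    + intros _. now apply Nat.ones_spec_low.
Qed.

(** * Digit sequences, least significant digit first *)

Fixpoint val (Q T : nat) (f : nat -> nat) : nat :=
  match T with
  | 0 => 0
  | S T => f 0 + Q * val Q T (fun t => f (S t))
  end.

Lemma val_ext Q T f g : (forall t, t < T -> f t = g t) -> val Q T f = val Q T g.
Proof.
  revert f g. induction T as [|T IH]; intros f g H; cbn [val]; [reflexivity|].
  rewrite (H 0), (IH (fun t => f (S t)) (fun t => g (S t))); [reflexivity| |lia].
  intros t Ht. apply H. lia.
Qed.

Lemma val_zero Q T : val Q T (fun _ => 0) = 0.
Proof. induction T as [|T IH]; cbn [val]; [|rewrite IH]; lia. Qed.

Lemma val_add Q T f g : val Q T (fun t => f t + g t) = val Q T f + val Q T g.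
Proof.
  revert f g. induction T as [|T IH]; intros f g; cbn [val]; [reflexivity|].
  rewrite IH. lia.
Qed.

Lemma val_mul Q T c f : val Q T (fun t => c * f t) = c * val Q T f.
Proof.
  revert f. induction T as [|T IH]; intros f; cbn [val]; [lia|].
  rewrite IH. lia.
Qed.

Lemma val_sum Q T N f :
  val Q T (fun t => sum N (fun i => f i t)) = sum N (fun i => val Q T (f i)).
Proof.
  revert f. induction N as [|N IH]; intros f; cbn [sum]; [apply val_zero|].
  now rewrite val_add, (IH (fun i => f (S i))).
Qed.

Lemma val_split Q a b f :
  val Q (a + b) f = val Q a f + Q ^ a * val Q b (fun t => f (a + t)).
Proof.
  revert f. induction a as [|a IH]; intros f; cbn [val Nat.add Nat.pow].
  - symmetry. apply Nat.mul_1_l.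
  - rewrite IH. lia.
Qed.

Lemma val_lt Q T f : (forall t, t < T -> f t < Q) -> val Q T f < Q ^ T.
Proof.
  revert f. induction T as [|T IH]; intros f H; cbn [val Nat.pow]; [lia|].
  specialize (IH (fun t => f (S t)) ltac:(intros; apply H; lia)).
  specialize (H 0 ltac:(lia)).
  apply (Nat.mul_le_mono_l _ _ Q) in IH. lia.
Qed.

(** The parts [x] and [y] above position [T] are unbounded, so the final value of a counter need not
    fit into a digit. *)
Lemma val_inj Q T f g x y :
  (forall t, t < T -> f t < Q) -> (forall t, t < T -> g t < Q) ->
  val Q T f + Q ^ T * x = val Q T g + Q ^ T * y ->
  (forall t, t < T -> f t = g t) /\ x = y.
Proof.
  revert f g. induction T as [|T IH]; intros f g Hf Hg; cbn [val Nat.pow]; intros E.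
  - split; [intros; lia|lia].
  - destruct (Nat.div_mod_unique Q (val Q T (fun t => f (S t)) + Q ^ T * x)
      (val Q T (fun t => g (S t)) + Q ^ T * y) (f 0) (g 0)) as [E1 E2];
      [apply Hf; lia|apply Hg; lia|lia|].
    apply IH in E1; [|intros; apply Hf; lia|intros; apply Hg; lia].
    destruct E1 as [E1 E3]. split; [|exact E3].
    intros [|t] Ht; [exact E2|apply E1; lia].
Qed.

Lemma val_repunit Q T : 0 < Q -> (Q - 1) * val Q T (fun _ => 1) + 1 = Q ^ T.
Proof.
  intros HQ. induction T as [|T IH]; cbn [val Nat.pow]; [lia|].
  rewrite <- IH. destruct Q as [|Q]; [lia|]. cbn [Nat.sub]. rewrite Nat.sub_0_r. lia.
Qed.

Lemma binomial_val U s : S U ^ s = val U (S s) (binom s).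
Proof.
  induction s as [|s IH]; [cbn; lia|].
  rewrite Nat.pow_succ_r', IH.
  (* The zero digit [binom s (S s)] is appended, so that Pascal's rule applies to every digit. *)
  assert (E : val U (S s) (binom s) = val U (S (S s)) (binom s)).
  { rewrite <- (Nat.add_1_r (S s)), val_split. cbn [val].
    rewrite Nat.add_0_r, (binom_gt s (S s)) by lia. lia. }
  change (val U (S (S s)) (binom (S s)))
    with (1 + U * val U (S s) (fun k => binom s k + binom s (S k))).
  rewrite val_add. rewrite E at 1.
  change (val U (S (S s)) (binom s)) with (binom s 0 + U * val U (S s) (fun k => binom s (S k))).
  change (val U (S (S s)) (binom s)) with (binom s 0 + U * val U (S s) (fun k => binom s (S k))) in E.
  rewrite binom_0 in *. nia.
Qed.

(* [binom s r] is the digit of index [r] of [(1 + U)^s] in base [U = 2^(s + 1)]. *)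
Definition mask_system (r s U lo c hi d : nat) : Prop :=
  U = 2 ^ S s /\ S U ^ s = lo + 2 ^ (S s * r) * (c + U * hi) /\
  lo < 2 ^ (S s * r) /\ c < U /\ c = 2 * d + 1.

Lemma mask_system_iff r s :
  mask r s <-> exists U lo c hi d, mask_system r s U lo c hi d.
Proof.
  rewrite mask_iff_binom, Nat.odd_spec.
  set (U := 2 ^ S s).
  assert (HU : forall k, binom s k < U).
  { intros k. pose proof (binom_le s k). pose proof (Nat.pow_nonzero 2 s).
    unfold U. rewrite Nat.pow_succ_r'. lia. }
  set (f := binom s) in *.
  assert (E : S U ^ s = val U r f + 2 ^ (S s * r) * (f r + U * val U s (fun t => f (r + S t)))).
  { rewrite Nat.pow_mul_r, binomial_val. fold U f.
    (* Appending [r] zero digits lets the split at position [r] cover [r > s] too. *)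
    assert (E1 : val U (S s + r) f = val U (S s) f).
    { rewrite val_split, (val_ext U r (fun t => f (S s + t)) (fun _ => 0)), val_zero; [lia|].
      intros t _. apply binom_gt. lia. }
    rewrite <- E1, Nat.add_comm, val_split. cbn [val]. rewrite Nat.add_0_r. reflexivity. }
  assert (Hlo : val U r f < 2 ^ (S s * r)).
  { rewrite Nat.pow_mul_r. apply val_lt. auto. }
  split.
  - intros [d Hd]. exists U, (val U r f), (f r), (val U s (fun t => f (r + S t))), d.
    repeat split; auto.
  - intros (U' & lo & c & hi & d & HU' & E' & Hl & Hc & Hd). exists d.
    fold U in HU'. subst U'. rewrite E in E'.
    destruct (Nat.div_mod_unique (2 ^ (S s * r)) (f r + U * val U s (fun t => f (r + S t)))
      (c + U * hi) (val U r f) lo) as [E1 _]; [assumption..|lia|].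
    destruct (Nat.div_mod_unique U (val U s (fun t => f (r + S t))) hi (f r) c) as [_ E2];
      [apply HU|assumption|lia|]. lia.
Qed.

Ltac dio_pow := dio; repeat (apply dio_pow_succ; dio).

Lemma dio_mask {V : Set} (e1 e2 : (V -> nat) -> nat) :
  DioFun e1 -> DioFun e2 -> Dio (fun r => mask (e1 r) (e2 r)).
Proof.
  apply dio_subst2.
  eapply dio_iff; [intros r; apply mask_system_iff|].
  unfold mask_system. dio_pow.
Qed.

Definition digit (Q X t : nat) : nat := X / Q ^ t mod Q.

(** In a base that is a power of two, digits are blocks of bits; one [mask] condition therefore
    bounds all digits at once. *)
Lemma mask_val p T X y : (forall t, t < T -> y t < 2 ^ p) -> mask X (val (2 ^ p) T y) ->
  X = val (2 ^ p) T (digit (2 ^ p) X) /\ forall t, t < T -> mask (digit (2 ^ p) X t) (y t).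
Proof.
  pose proof (Nat.pow_nonzero 2 p ltac:(lia)) as HQ.
  revert X y. induction T as [|T IH]; intros X y Hy HX; cbn [val] in *.
  - split; [now apply mask_0_r|intros; lia].
  - assert (E : forall t, digit (2 ^ p) X (S t) = digit (2 ^ p) (X / 2 ^ p) t).
    { intros t. unfold digit. now rewrite Nat.pow_succ_r', Nat.Div0.div_div. }
    assert (E0 : digit (2 ^ p) X 0 = X mod 2 ^ p).
    { unfold digit. now rewrite Nat.pow_0_r, Nat.div_1_r. }
    pose proof (Nat.div_mod_eq X (2 ^ p)) as EX.
    rewrite EX, Nat.add_comm in HX.
    apply mask_split in HX; [|apply Nat.mod_upper_bound, HQ|apply Hy; lia].
    destruct HX as [HX1 HX2].
    apply IH in HX2; [|intros; apply Hy; lia]. destruct HX2 as [IH1 IH2].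
    split.
    + rewrite E0, (val_ext _ _ _ _ (fun t _ => E t)), <- IH1. lia.
    + intros [|t] Ht; [now rewrite E0|]. rewrite E. apply IH2. lia.
Qed.

Lemma mask_val_intro p T x y : (forall t, t < T -> y t < 2 ^ p) ->
  (forall t, t < T -> mask (x t) (y t)) -> mask (val (2 ^ p) T x) (val (2 ^ p) T y).
Proof.
  revert x y. induction T as [|T IH]; intros x y Hy H; cbn [val]; [apply mask_0|].
  pose proof (mask_le _ _ (H 0 ltac:(lia))). pose proof (Hy 0 ltac:(lia)).
  apply mask_split; [lia|lia|]. split; [apply H; lia|].
  apply IH; intros; [apply Hy|apply H]; lia.
Qed.

(** * Counter systems *)

Lemma sum_ext N f g : (forall i, i < N -> f i = g i) -> sum N f = sum N g.
Proof.
  revert f g. induction N as [|N IH]; intros f g H; cbn [sum]; [reflexivity|].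
  rewrite (H 0), (IH (fun i => f (S i)) (fun i => g (S i))); [reflexivity| |lia].
  intros i Hi. apply H. lia.
Qed.

Lemma sum_zero N : sum N (fun _ => 0) = 0.
Proof. induction N; auto. Qed.

Lemma sum_le N f g : (forall i, i < N -> f i <= g i) -> sum N f <= sum N g.
Proof.
  revert f g. induction N as [|N IH]; intros f g H; cbn [sum]; [lia|].
  apply Nat.add_le_mono; [apply H; lia|]. apply IH. intros i Hi. apply H. lia.
Qed.

Lemma sum_ge N f i : i < N -> f i <= sum N f.
Proof.
  revert f i. induction N as [|N IH]; intros f i H; cbn [sum]; [lia|].
  destruct i as [|i]; [lia|]. specialize (IH (fun i => f (S i)) i). cbn in IH. lia.
Qed.

Lemma sum_0_inv N f : sum N f = 0 -> forall i, i < N -> f i = 0.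
Proof. intros H i Hi. pose proof (sum_ge N f i Hi). lia. Qed.

(** Weighting by a one-hot family selects a single value; so the transition fired at a given time is
    read off. *)
Lemma sum_1_inv N f : sum N f = 1 ->
  exists i, i < N /\ f i = 1 /\ forall g, sum N (fun k => g k * f k) = g i.
Proof.
  revert f. induction N as [|N IH]; intros f H; cbn [sum] in H; [discriminate|].
  destruct (f 0) as [|[|]] eqn:E; [| |lia].
  - destruct (IH (fun i => f (S i)) H) as [i [Hi [Ei Hs]]].
    exists (S i). split; [lia|]. split; [exact Ei|]. intros g. cbn [sum].
    rewrite (Hs (fun k => g (S k))), E. lia.
  - exists 0. split; [lia|]. split; [exact E|]. intros g. cbn [sum].
    rewrite E, (sum_ext _ _ (fun _ => 0)), sum_zero; [lia|].
    intros i Hi. rewrite (sum_0_inv N (fun i => f (S i))) by lia. lia.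
Qed.

Lemma sum_delta N g i : i < N -> sum N (fun k => g k * (if i =? k then 1 else 0)) = g i.
Proof.
  revert g i. induction N as [|N IH]; intros g i Hi; [lia|].
  destruct i as [|i]; cbn [sum Nat.eqb].
  - rewrite (sum_ext _ _ (fun _ => 0)), sum_zero; [lia|]. intros; lia.
  - rewrite (IH (fun k => g (S k))) by lia. lia.
Qed.

Section CounterSystem.

(* Transition [i < N] needs [pre i j] tokens in each counter [j < n], replaces them by
   [post i j] tokens, and requires [j] to be empty if [zer i j]. *)
Variables (n N : nat) (pre post : nat -> nat -> nat) (zer : nat -> nat -> bool).
(** With at most one token moved, a digit of [D] plus that token is at most [h + 1], below the base:
    no carries. *)
Hypothesis pre_le : forall i j, pre i j <= 1.
Hypothesis post_le : forall i j, post i j <= 1.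

Definition fire (i : nat) (c c' : nat -> nat) : Prop :=
  forall j, j < n -> exists d, c j = d + pre i j /\ c' j = d + post i j /\
    (zer i j = true -> c j = 0).

Inductive run : (nat -> nat) -> (nat -> nat) -> Prop :=
| run_refl c c' : (forall j, j < n -> c j = c' j) -> run c c'
| run_fire i c1 c2 c3 : i < N -> fire i c1 c2 -> run c2 c3 -> run c1 c3.

Lemma run_trace c c' : run c c' -> exists T f tr,
  (forall j, j < n -> f 0 j = c j) /\ (forall j, j < n -> f T j = c' j) /\
  forall t, t < T -> tr t < N /\ fire (tr t) (f t) (f (S t)).
Proof.
  induction 1 as [c c' H|i c1 c2 c3 Hi Hf _ [T [f [tr [H0 [HT H]]]]]].
  - exists 0, (fun _ => c), (fun _ => 0). repeat split; auto; lia.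
  - exists (S T), (fun t => match t with 0 => c1 | S t => f t end),
      (fun t => match t with 0 => i | S t => tr t end).
    split; [reflexivity|]. split; [exact HT|].
    intros [|t] Ht; [|apply H; lia]. split; [exact Hi|].
    intros j Hj. rewrite H0 by exact Hj. now apply Hf.
Qed.

(* Base-[2 * S h] digits at position [t]: [L i] marks the times at which transition [i]
   fires, [C j] holds the value of counter [j] and [D j] that value minus the tokens
   consumed.  The most significant bit of every digit of [C] and [D] is kept free. *)
Definition run_system (init fin : nat -> nat) (p T h I : nat) (C D L : nat -> nat) : Prop :=
  S h = 2 ^ p /\ (2 * h + 1) * I + 1 = 2 ^ (S p * T) /\ N <= S h /\
  (forall i, i < N -> mask (L i) I) /\ sum N L = I /\
  forall j, j < n -> init j < 2 * S h /\ mask (C j) (h * I) /\ mask (D j) (h * I) /\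
    C j = D j + sum N (fun i => pre i j * L i) /\
    init j + 2 * S h * (D j + sum N (fun i => post i j * L i))
      = C j + 2 ^ (S p * T) * fin j /\
    forall i, i < N -> zer i j = true -> mask (C j + h * L i) (h * I).

Lemma run_system_sound init fin p T h I C D L :
  run_system init fin p T h I C D L -> run init fin.
Proof.
  intros (Hh & HI & HN & HL & HS & HC).
  set (Q := 2 ^ S p).
  assert (HQ : Q = 2 * S h) by (unfold Q; now rewrite Nat.pow_succ_r', Hh).
  rewrite Nat.pow_mul_r in HI, HC. fold Q in HI, HC.
  (* [2 * h + 1] is [Q - 1], so [I] is the geometric sum with all digits 1. *)
  assert (HI1 : I = val Q T (fun _ => 1)).
  { pose proof (val_repunit Q T ltac:(lia)) as E. rewrite <- HI in E.
    replace (Q - 1) with (2 * h + 1) in E by lia. nia. }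
  assert (HhI : h * I = val Q T (fun _ => h)).
  { rewrite HI1, <- val_mul. apply val_ext. intros; lia. }
  assert (HL1 : forall i, i < N -> L i = val Q T (digit Q (L i)) /\
    forall t, t < T -> digit Q (L i) t <= 1).
  { intros i Hi. specialize (HL i Hi). rewrite HI1 in HL. apply mask_val in HL; [|fold Q; lia].
    destruct HL as [HL HL']. split; [exact HL|]. intros t Ht. now apply mask_le, HL'. }
  assert (Hh1 : forall X, mask X (h * I) -> X = val Q T (digit Q X) /\
    forall t, t < T -> digit Q X t <= h).
  { intros X HX. rewrite HhI in HX. apply mask_val in HX; [|fold Q; lia].
    destruct HX as [HX HX']. split; [exact HX|]. intros t Ht. now apply mask_le, HX'. }
  set (l := fun i t => digit Q (L i) t) in *.
  assert (Hsum : forall g, sum N (fun i => g i * L i) = val Q T (fun t => sum N (fun i => g i * l i t))).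
  { intros g. rewrite val_sum. apply sum_ext. intros i Hi.
    rewrite val_mul. f_equal. apply (HL1 i Hi). }
  (* Each column sum is at most [N], below [Q]; without carries, [sum N L = I] holds digit by
     digit. *)
  assert (Hone : forall t, t < T -> sum N (fun i => l i t) = 1).
  { apply (val_inj Q T _ _ 0 0).
    - intros t Ht. apply Nat.le_lt_trans with N; [|lia].
      apply Nat.le_trans with (sum N (fun _ => 1)).
      + apply sum_le. intros i Hi. now apply (HL1 i Hi).
      + clear. induction N; cbn [sum]; lia.
    - intros; lia.
    - rewrite val_sum, <- HI1, <- HS. f_equal. apply sum_ext. intros i Hi.
      symmetry. apply (HL1 i Hi). }
  assert (Htr : forall t, exists i, t < T -> i < N /\ l i t = 1 /\
    forall g, sum N (fun k => g k * l k t) = g i).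
  { intros t. destruct (le_lt_dec T t) as [Ht|Ht]; [exists 0; lia|].
    destruct (sum_1_inv _ _ (Hone t Ht)) as [i Hi]. exists i. auto. }
  (* Multiplying by the base shifts time by one: the update equation identifies [g] with the digits
     of [C j], topped by [fin j]. *)
  set (g := fun t j => match t with
    | 0 => init j
    | S t => digit Q (D j) t + sum N (fun i => post i j * l i t) end).
  assert (Hg : forall j, j < n -> (forall t, t < T -> g t j = digit Q (C j) t) /\ g T j = fin j).
  { intros j Hj. destruct (HC j Hj) as (Hi & HCj & HDj & _ & E & _).
    destruct (Hh1 _ HCj) as [EC HC1]. destruct (Hh1 _ HDj) as [ED HD1].
    apply (val_inj Q).
    - intros [|t] Ht; cbn [g]; [lia|].
      destruct (Htr t) as [i Hi']. destruct Hi' as [_ [_ ->]]; [lia|].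
      pose proof (HD1 t ltac:(lia)). pose proof (post_le i j). lia.
    - intros t Ht. specialize (HC1 t Ht). lia.
    - rewrite <- EC, <- E.
      transitivity (val Q (T + 1) (fun t => g t j)).
      + rewrite val_split. cbn [val]. rewrite !Nat.add_0_r, Nat.mul_0_r, Nat.add_0_r. reflexivity.
      + rewrite Nat.add_1_r. cbn [val g]. rewrite val_add, <- ED, <- Hsum, HQ. reflexivity. }
  assert (Hpre : forall j, j < n -> forall t, t < T ->
    digit Q (C j) t = digit Q (D j) t + sum N (fun i => pre i j * l i t)).
  { intros j Hj. destruct (HC j Hj) as (_ & HCj & HDj & E & _ & _).
    destruct (Hh1 _ HCj) as [EC HC1]. destruct (Hh1 _ HDj) as [ED HD1].
    apply (val_inj Q T _ _ 0 0).
    - intros t Ht. specialize (HC1 t Ht). lia.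
    - intros t Ht. destruct (Htr t) as [i Hi]. destruct (Hi Ht) as [_ [_ ->]].
      pose proof (HD1 t Ht). pose proof (pre_le i j). lia.
    - rewrite val_add, <- Hsum, <- EC, <- ED, E. reflexivity. }
  (* When [i] fires, [h] is added to the digit of [C j]; the sum may not exceed [h], so that digit
     is 0. *)
  assert (Hzero : forall i j, i < N -> j < n -> zer i j = true -> forall t, t < T ->
    l i t = 1 -> digit Q (C j) t = 0).
  { intros i j Hi Hj Hzer. destruct (HC j Hj) as (_ & HCj & _ & _ & _ & Hz).
    destruct (Hh1 _ HCj) as [EC HC1]. destruct (Hh1 _ (Hz i Hi Hzer)) as [EX HX1].
    assert (E : forall t, t < T -> digit Q (C j) t + h * l i t = digit Q (C j + h * L i) t).
    { apply (val_inj Q T _ _ 0 0).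
      - intros t Ht. specialize (HC1 t Ht). pose proof (proj2 (HL1 i Hi) t Ht) as H1.
        unfold l. nia.
      - intros t Ht. specialize (HX1 t Ht). lia.
      - rewrite val_add, val_mul, <- EX, <- EC. do 3 f_equal.
        symmetry. apply (HL1 i Hi). }
    intros t Ht Hl. specialize (HX1 t Ht). rewrite <- E, Hl in HX1 by exact Ht. lia. }
  assert (Hrun : forall t, t <= T -> run (g (T - t)) fin).
  { induction t as [|t IH]; intros Ht.
    - rewrite Nat.sub_0_r. apply run_refl. intros j Hj. apply (Hg j Hj).
    - set (s := T - S t). replace (T - t) with (S s) in IH by lia.
      assert (Hs : s < T) by lia.
      destruct (Htr s) as [i Hi]. destruct (Hi Hs) as [HiN [Hl Hg1]].
      apply run_fire with (i := i) (c2 := g (S s)); [exact HiN| |apply IH; lia].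
      intros j Hj. rewrite (proj1 (Hg j Hj) s Hs). cbn [g]. rewrite Hg1.
      exists (digit Q (D j) s). split; [|split; [reflexivity|]].
      + now rewrite (Hpre j Hj s Hs), Hg1.
      + intros Hzer. now apply Hzero with i. }
  specialize (Hrun T (le_n T)). rewrite Nat.sub_diag in Hrun. exact Hrun.
Qed.

Lemma run_system_complete init fin : run init fin ->
  exists p T h I C D L, run_system init fin p T h I C D L.
Proof.
  intros H. destruct (run_trace _ _ H) as [T [f [tr [H0 [HT Hf]]]]]. clear H.
  set (B := sum (S T) (fun t => sum n (f t))).
  assert (HB : forall t j, t <= T -> j < n -> f t j <= B).
  { intros t j Ht Hj. apply Nat.le_trans with (sum n (f t)); [now apply sum_ge|].
    apply (sum_ge (S T) (fun t => sum n (f t))). lia. }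
  (* From [2^p > B + N], digits up to [h] hold every counter value, and [N <= S h]. *)
  set (p := B + N). pose proof (Nat.pow_gt_lin_r 2 p ltac:(lia)) as Hp.
  set (h := 2 ^ p - 1). set (Q := 2 ^ S p).
  assert (HQ : Q = 2 * S h) by (unfold Q, h; rewrite Nat.pow_succ_r'; lia).
  set (l := fun i t => if tr t =? i then 1 else 0).
  assert (Hsum : forall g, sum N (fun i => g i * val Q T (l i)) = val Q T (fun t => g (tr t))).
  { intros g. transitivity (val Q T (fun t => sum N (fun i => g i * l i t))).
    - rewrite val_sum. apply sum_ext. intros i _. now rewrite val_mul.
    - apply val_ext. intros t Ht. apply sum_delta. now apply Hf. }
  assert (HhI : h * val Q T (fun _ => 1) = val Q T (fun _ => h)).
  { rewrite <- val_mul. apply val_ext. intros; lia. }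
  assert (Hmask : forall x, (forall t, t < T -> x t <= h) -> mask (val Q T x) (val Q T (fun _ => h))).
  { intros x Hx. apply mask_val_intro; [fold Q; lia|]. intros t Ht. apply mask_ones.
    specialize (Hx t Ht). lia. }
  exists p, T, h, (val Q T (fun _ => 1)), (fun j => val Q T (fun t => f t j)),
    (fun j => val Q T (fun t => f t j - pre (tr t) j)), (fun i => val Q T (l i)).
  unfold run_system. rewrite Nat.pow_mul_r. fold Q. rewrite HhI.
  split; [lia|]. split.
  { rewrite <- (val_repunit Q T) by lia. f_equal. f_equal. lia. }
  split; [lia|]. split.
  { intros i _. apply mask_val_intro; [fold Q; lia|].
    intros t _. unfold l. destruct (tr t =? i); [apply mask_refl|apply mask_0]. }
  split.
  { rewrite <- (Hsum (fun _ => 1)). apply sum_ext. intros; lia. }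
  intros j Hj. split; [rewrite <- H0 by exact Hj; specialize (HB 0 j); lia|].
  split; [apply Hmask; intros t Ht; specialize (HB t j); lia|].
  split; [apply Hmask; intros t Ht; specialize (HB t j); lia|].
  split; [|split].
  - rewrite (Hsum (fun i => pre i j)), <- val_add. apply val_ext. intros t Ht.
    destruct (proj2 (Hf t Ht) j Hj) as [d [E _]]. lia.
  - rewrite (Hsum (fun i => post i j)), <- val_add, <- HQ, <- H0, <- HT by exact Hj.
    rewrite (val_ext Q T _ (fun t => f (S t) j)).
    + transitivity (val Q (T + 1) (fun t => f t j)).
      * rewrite Nat.add_1_r. reflexivity.
      * rewrite val_split. cbn [val]. rewrite !Nat.add_0_r, Nat.mul_0_r, Nat.add_0_r. reflexivity.
    + intros t Ht. destruct (proj2 (Hf t Ht) j Hj) as [d [E1 [E2 _]]]. lia.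
  - intros i Hi Hz. rewrite <- val_mul, <- val_add. apply Hmask. intros t Ht.
    unfold l. destruct (Nat.eqb_spec (tr t) i) as [E|_].
    + destruct (proj2 (Hf t Ht) j Hj) as [d [_ [_ E0]]]. rewrite E in E0. rewrite (E0 Hz). lia.
    + specialize (HB t j). lia.
Qed.

Lemma dio_run : Dio (fun r : nat + nat -> nat => run (fun j => r (inl j)) (fun j => r (inr j))).
Proof.
  apply dio_iff with (R' := fun r : nat + nat -> nat => exists p T h I C D L,
    run_system (fun j => r (inl j)) (fun j => r (inr j)) p T h I C D L).
  - intros r. split; [apply run_system_complete|].
    intros (p & T & h & I & C & D & L & H). now apply run_system_sound in H.
  - do 4 apply dio_ex. do 3 apply dio_exfun. unfold run_system.
    repeat first
      [ apply dio_and | apply dio_all; intros ? | apply dio_imp; [apply Bool.bool_dec|]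
      | apply dio_mask | apply dio_sum; intros ? | apply dio_pow_succ | progress cbv beta | progress dio ].
Qed.

End CounterSystem.

(** * Counter machines *)

Section Machine.
Variable P : program.

Definition delta (i j : nat) : nat := if i =? j then 1 else 0.

Definition reg_at (p : nat) : nat :=
  match nth_error P p with Some (INC r) | Some (DEC r _) => r | None => 0 end.

(** A crude bound: the sum dominates each register index. The successor ensures that register 0,
    which holds input and output, is always tracked. *)
Definition nregs : nat := S (sum (length P) reg_at).

Lemma reg_at_lt p : p < length P -> reg_at p < nregs.
Proof.
  intros H. apply Nat.lt_succ_r. now apply sum_ge.
Qed.

(* Counters [0, ..., length P] encode the program counter in unary one-hot form, all halting
   addresses being merged into [length P]; register [r] is counter [S (length P) + r].
   Address [p] owns the transitions [2 * p] and [S (2 * p)]. *)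
Definition tpre (i j : nat) : nat :=
  match nth_error P (Nat.div2 i) with
  | Some (INC _) => delta (Nat.div2 i) j
  | Some (DEC r _) =>
      if Nat.odd i then delta (Nat.div2 i) j
      else delta (Nat.div2 i) j + delta (S (length P) + r) j
  | None => 0
  end.

Definition tpost (i j : nat) : nat :=
  match nth_error P (Nat.div2 i) with
  | Some (INC r) => delta (S (Nat.div2 i)) j + delta (S (length P) + r) j
  | Some (DEC _ k) =>
      if Nat.odd i then delta (Nat.min k (length P)) j else delta (S (Nat.div2 i)) j
  | None => 0
  end.

(** For a [DEC], the odd transition is the jump on zero and the even one the decrement; for an [INC]
    both do the same. *)
Definition tzer (i j : nat) : bool :=
  match nth_error P (Nat.div2 i) with
  | Some (DEC r _) => Nat.odd i && (j =? S (length P) + r)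
  | _ => false
  end.

Definition counters (c : config) (j : nat) : nat :=
  if j <=? length P then delta (Nat.min (fst c) (length P)) j else snd c (j - S (length P)).

Definition mrun := run (S (length P) + nregs) (2 * length P) tpre tpost tzer.

Lemma nth_error_lt p x : nth_error P p = Some x -> p < length P.
Proof. intros H. apply nth_error_Some. congruence. Qed.

Ltac cases :=
  repeat match goal with
  | |- context [?a =? ?b] => destruct (Nat.eqb_spec a b)
  | |- context [?a <=? ?b] => destruct (Nat.leb_spec a b)
  | H : context [?a =? ?b] |- _ => destruct (Nat.eqb_spec a b)
  | H : context [?a <=? ?b] |- _ => destruct (Nat.leb_spec a b)
  end.

(** Address counters lie below all register counters, so two [delta] terms never meet. *)
Lemma tpre_le i j : tpre i j <= 1.
Proof.
  unfold tpre. destruct (nth_error P (Nat.div2 i)) as [[r|r k]|] eqn:E; [..|lia];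
    apply nth_error_lt in E; try destruct (Nat.odd i); unfold delta; cases; lia.
Qed.

Lemma tpost_le i j : tpost i j <= 1.
Proof.
  unfold tpost. destruct (nth_error P (Nat.div2 i)) as [[r|r k]|] eqn:E; [..|lia];
    apply nth_error_lt in E; try destruct (Nat.odd i); unfold delta; cases; lia.
Qed.

Lemma step_fire c c' : step P c c' -> exists i, i < 2 * length P /\
  fire (S (length P) + nregs) tpre tpost tzer i (counters c) (counters c').
Proof.
  intros H. destruct H as [pc regs r E|pc regs r k E E0|pc regs r k x E E0];
    assert (Hp := nth_error_lt _ _ E).
  - exists (2 * pc). split; [lia|]. intros j Hj.
    unfold tpre, tpost, tzer. rewrite Nat.div2_double, E.
    exists (counters (pc, regs) j - delta pc j).
    unfold counters, delta, upd; cbn [fst snd].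
    cases; subst; repeat split; try discriminate; try lia.
    all: try (replace (S (length P) + r - S (length P)) with r by lia; lia).
  - exists (S (2 * pc)). split; [lia|]. intros j Hj.
    unfold tpre, tpost, tzer. rewrite Nat.div2_succ_double, E, Nat.odd_succ, Nat.even_mul.
    exists (counters (pc, regs) j - delta pc j).
    unfold counters, delta, upd; cbn [fst snd orb andb Nat.even].
    cases; subst; repeat split; try discriminate; try lia.
    all: try (replace (S (length P) + r - S (length P)) with r by lia; lia).
  - exists (2 * pc). split; [lia|]. intros j Hj.
    unfold tpre, tpost, tzer. rewrite Nat.div2_double, E, Nat.odd_mul.
    cbn [Nat.odd Nat.even negb andb].
    exists (counters (pc, regs) j - (delta pc j + delta (S (length P) + r) j)).
    unfold counters, delta, upd; cbn [fst snd].
    cases; subst; repeat split; try discriminate; try lia.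
    all: try (replace (S (length P) + r - S (length P)) with r by lia; lia).
Qed.

Lemma fire_step i c d : i < 2 * length P ->
  fire (S (length P) + nregs) tpre tpost tzer i (counters c) d ->
  exists c', step P c c' /\ forall j, j < S (length P) + nregs -> d j = counters c' j.
Proof.
  intros Hi H.
  assert (Hp : Nat.div2 i < length P) by (rewrite Nat.div2_div; apply Nat.Div0.div_lt_upper_bound; lia).
  assert (Hr := reg_at_lt _ Hp). unfold reg_at in Hr.
  set (p := Nat.div2 i) in *.
  destruct c as [pc regs].
  (* As [p < length P], the merging of halting addresses cannot produce a token at [p]. *)
  assert (Hpc : tpre i p = 1 -> pc = p).
  { intros E. destruct (H p ltac:(lia)) as [x [Hx _]]. rewrite E in Hx.
    unfold counters, delta in Hx; cbn [fst snd] in Hx. cases; lia. }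
  destruct (nth_error P p) as [[r|r k]|] eqn:E; [| |apply nth_error_None in E; lia].
  - assert (pc = p).
    { apply Hpc. unfold tpre. fold p. rewrite E. unfold delta. now rewrite Nat.eqb_refl. }
    subst pc. exists (S p, upd regs r (S (regs r))). split; [now constructor|].
    intros j Hj. destruct (H j Hj) as [x [H1 [-> _]]]. revert H1.
    unfold tpre, tpost. fold p. rewrite E. unfold counters, delta, upd; cbn [fst snd].
    cases; subst; try lia.
    all: try (replace (S (length P) + r - S (length P)) with r by lia; lia).
  - assert (Hrr := H (S (length P) + r) ltac:(lia)).
    unfold counters in Hrr; cbn [fst snd] in Hrr.
    destruct (Nat.leb_spec (S (length P) + r) (length P)); [lia|].
    replace (S (length P) + r - S (length P)) with r in Hrr by lia.
    destruct (Nat.odd i) eqn:Ho.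
    + assert (pc = p).
      { apply Hpc. unfold tpre. fold p. rewrite E, Ho. unfold delta. now rewrite Nat.eqb_refl. }
      subst pc. exists (k, regs). split.
      * apply step_dec_zero with r; [exact E|].
        destruct Hrr as [x [_ [_ Hz]]]. apply Hz. unfold tzer. fold p.
        rewrite E, Ho, Nat.eqb_refl. reflexivity.
      * intros j Hj. destruct (H j Hj) as [x [H1 [-> _]]]. revert H1.
        unfold tpre, tpost. fold p. rewrite E, Ho. unfold counters, delta; cbn [fst snd].
        cases; subst; lia.
    + assert (pc = p).
      { apply Hpc. unfold tpre. fold p. rewrite E, Ho. unfold delta. cases; lia. }
      subst pc. exists (S p, upd regs r (regs r - 1)). split.
      * apply step_dec_succ with k; [exact E|].
        destruct Hrr as [x [Hx _]]. revert Hx. unfold tpre. fold p. rewrite E, Ho.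
        unfold delta. cases; lia.
      * intros j Hj. destruct (H j Hj) as [x [H1 [-> _]]]. revert H1.
        unfold tpre, tpost. fold p. rewrite E, Ho. unfold counters, delta, upd; cbn [fst snd].
        cases; subst; try lia.
        all: try (replace (S (length P) + r - S (length P)) with r by lia; lia).
Qed.

Lemma steps_run c c' : steps P c c' -> mrun (counters c) (counters c').
Proof.
  induction 1 as [c|c1 c2 c3 H _ IH].
  - now apply run_refl.
  - destruct (step_fire _ _ H) as [i [Hi Hf]]. now apply run_fire with i (counters c2).
Qed.

Lemma run_steps d d' : mrun d d' ->
  forall c, (forall j, j < S (length P) + nregs -> d j = counters c j) ->
  exists c', steps P c c' /\ forall j, j < S (length P) + nregs -> d' j = counters c' j.
Proof.
  induction 1 as [d d' H|i d1 d2 d3 Hi Hf _ IH]; intros c Hc.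
  - exists c. split; [constructor|]. intros j Hj. rewrite <- H; auto.
  - destruct (fire_step i c d2 Hi) as [c2 [Hs H2]].
    { intros j Hj. rewrite <- Hc by exact Hj. now apply Hf. }
    destruct (IH c2 H2) as [c3 [Hs' H3]].
    exists c3. split; [now apply steps_step with c2|exact H3].
Qed.

Definition start (k : nat) : config := (0, fun r => if r =? 0 then k else 0).

(** The end points are quantified and [init] is fixed on the tracked counters only, in the form that
    [dio_exfun] and [dio_all] accept. *)
Lemma halts_with_run k v : halts_with P k v <->
  exists init fin, (forall j, j < S (length P) + nregs -> init j = counters (start k) j) /\
    mrun init fin /\ fin (length P) = 1 /\ fin (S (length P)) = v.
Proof.
  split.
  - intros (pc & regs & Hs & Hpc & Hv).
    exists (counters (start k)), (counters (pc, regs)).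
    split; [reflexivity|]. split; [now apply steps_run|].
    unfold counters, delta; cbn [fst snd]. split; cases; try lia.
    now rewrite Nat.sub_diag.
  - intros (init & fin & H0 & Hr & H1 & Hv).
    destruct (run_steps _ _ Hr (start k) H0) as [[pc regs] [Hs Hc]].
    exists pc, regs. split; [exact Hs|].
    rewrite Hc in H1 by (unfold nregs; lia). rewrite Hc in Hv by (unfold nregs; lia).
    revert H1 Hv. unfold counters, delta; cbn [fst snd].
    rewrite Nat.sub_diag. cases; try lia; auto.
Qed.

Lemma dio_halts_with {V : Set} (e1 e2 : (V -> nat) -> nat) :
  DioFun e1 -> DioFun e2 -> Dio (fun r => halts_with P (e1 r) (e2 r)).
Proof.
  apply dio_subst2.
  eapply dio_iff; [intros r; apply halts_with_run|].
  do 2 apply dio_exfun. apply dio_and; [|apply dio_and; [|dio]].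
  - apply dio_all. intros j. apply dio_eq; [dio|].
    unfold counters, start, delta; cbn [fst snd].
    destruct (j <=? length P), (j - S (length P) =? 0); dio.
  - exact (dio_ren (fun x => match x with inl j => inr (inl j) | inr j => inl j end) _
      (dio_run (S (length P) + nregs) (2 * length P) tpre tpost tzer tpre_le tpost_le)).
Qed.

Lemma step_deterministic c c1 c2 : step P c c1 -> step P c c2 -> c1 = c2.
Proof.
  intros H1 H2. destruct H1; inversion H2; subst; try congruence.
  all: replace r0 with r in * by congruence; congruence.
Qed.

Lemma steps_halted_unique c c1 c2 : steps P c c1 -> length P <= fst c1 ->
  steps P c c2 -> length P <= fst c2 -> c1 = c2.
Proof.
  assert (stuck : forall c c', length P <= fst c -> step P c c' -> False).
  { intros d d' Hd H. destruct H as [? ? ? E|? ? ? ? E|? ? ? ? ? E]; apply nth_error_lt in E;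
      cbn in Hd; lia. }
  intros H1 Hc1. induction H1 as [d|d d' d'' H _ IH]; intros H2 Hc2.
  - destruct H2 as [|? ? ? H]; [reflexivity|]. now apply stuck in H.
  - destruct H2 as [e|e e' e'' He H2]; [now apply stuck in H|].
    rewrite (step_deterministic _ _ _ H He) in *. now apply IH.
Qed.

Lemma halts_with_unique k v v' : halts_with P k v -> halts_with P k v' -> v = v'.
Proof.
  intros (pc & regs & H & Hpc & <-) (pc' & regs' & H' & Hpc' & <-).
  pose proof (steps_halted_unique _ _ _ H Hpc H' Hpc') as E. congruence.
Qed.

End Machine.

(** * The diagonal sentence *)

(** A product of consecutive numbers is even, so the division is exact and the graph of [cpair] is a
    quadratic equation. *)
Lemma cpair_double a b : 2 * cpair a b = (a + b) * (a + b + 1) + 2 * b.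
Proof.
  unfold cpair.
  assert (H : exists q, (a + b) * (a + b + 1) = 2 * q).
  { generalize (a + b). intros s. destruct (Nat.Even_or_Odd s) as [[k ->]|[k ->]].
    - exists (k * (2 * k + 1)). lia.
    - exists ((2 * k + 1) * (k + 1)). lia. }
  destruct H as [q H]. rewrite H, (Nat.mul_comm 2 q), Nat.div_mul; lia.
Qed.

Lemma cpair_ge a b : a <= cpair a b /\ b <= cpair a b.
Proof. pose proof (cpair_double a b). nia. Qed.

Lemma dio_cpair {V : Set} (e1 e2 : (V -> nat) -> nat) :
  DioFun e1 -> DioFun e2 -> DioFun (fun r => cpair (e1 r) (e2 r)).
Proof.
  apply dio_fun_of2.
  apply dio_iff with (R' := fun r : nat -> nat =>
    2 * r 0 = (r 1 + r 2) * (r 1 + r 2 + 1) + 2 * r 2); [|dio].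
  intros r. pose proof (cpair_double (r 1) (r 2)). lia.
Qed.

Lemma length_le_encZs l : length l <= encZs l.
Proof.
  induction l as [|z l IH]; cbn [length encZs]; [lia|].
  pose proof (cpair_ge (encZ z) (encZs l)). lia.
Qed.

Lemma wf_linxy_enc f k : enc_linxy f <= k -> wf_linxy k k f.
Proof.
  unfold enc_linxy, wf_linxy.
  pose proof (length_le_encZs (lxy_xcoef f)). pose proof (length_le_encZs (lxy_ycoef f)).
  pose proof (cpair_ge (encZs (lxy_ycoef f)) (encZ (lxy_const f))).
  pose proof (cpair_ge (encZs (lxy_xcoef f)) (cpair (encZs (lxy_ycoef f)) (encZ (lxy_const f)))).
  lia.
Qed.

Lemma wf_linx_enc f k : enc_linx f <= k -> wf_linx k f.
Proof.
  unfold enc_linx, wf_linx. pose proof (length_le_encZs (lx_coef f)).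
  pose proof (cpair_ge (encZs (lx_coef f)) (encZ (lx_const f))). lia.
Qed.

(** Each list cell adds a successor and [cpair] dominates its arguments, so a code bounds all
    coefficient lists inside it. *)
Lemma wf_pfml_enc p k : enc_pfml p <= k -> wf_pfml k k p.
Proof.
  induction p as [f g|f g|f g|p IHp q IHq|p IHp q IHq]; cbn [enc_pfml wf_pfml]; intros H;
    match type of H with cpair ?t (cpair ?a ?b) <= _ =>
      pose proof (cpair_ge t (cpair a b)); pose proof (cpair_ge a b) end;
    split; first [apply wf_linxy_enc | apply wf_linx_enc | apply IHp | apply IHq]; lia.
Qed.

(** * Positive formulas for violated atoms *)

Section Violation.
Local Open Scope Z_scope.

Definition monomial (i : nat) (c : Z) : list Z := repeat 0 i ++ [c].

Fixpoint vadd (l1 l2 : list Z) : list Z :=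
  match l1, l2 with
  | [], _ => l2
  | _, [] => l1
  | a :: l1, b :: l2 => a + b :: vadd l1 l2
  end.

Lemma dot_monomial i c xs : dot (monomial i c) xs = c * nth i xs 0.
Proof.
  revert xs. unfold monomial. induction i as [|i IH]; intros [|x xs]; cbn [repeat app dot nth];
    rewrite ?IH; lia.
Qed.

Lemma dot_vadd l1 l2 xs : dot (vadd l1 l2) xs = dot l1 xs + dot l2 xs.
Proof.
  revert l2 xs. induction l1 as [|a l1 IH]; intros [|b l2] [|x xs]; cbn [vadd dot];
    rewrite ?IH; lia.
Qed.

Definition constant (c : Z) : linxy := LinXY [] [] c.
Definition xvar (i : nat) : linxy := LinXY (monomial i 1) [] 0.
Definition yvar : linxy := LinXY [] [1] 0.
Definition neq (f g : linxy) : pfml := POr (PLt f g) (PLt g f).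
Definition negative (i : nat) : pfml := PLt (xvar i) (constant 0).

(* For [x, z >= 0] put [t = z + 3 x + 2].  Then [z = x^2] iff [t = lcm (x + 1, x + 2)], iff
   no [y] is a multiple of [x + 1] in the open interval [(t, t + x + 1)], a multiple of
   [x + 2] in [(t, t + x + 2)], or a common multiple in [(0, t)]. *)
Definition not_square (x z : nat) : pfml :=
  let t n c := LinXY (vadd (monomial z 1) (monomial x n)) [] c in
  let d c := PDvd (LinX (monomial x 1) c) yvar in
  POr (PAnd (d 1) (PAnd (PLt (t 3 2) yvar) (PLt yvar (t 4 3))))
    (POr (PAnd (d 2) (PAnd (PLt (t 3 2) yvar) (PLt yvar (t 4 4))))
      (PAnd (d 1) (PAnd (d 2) (PAnd (PLt (constant 0) yvar) (PLt yvar (t 3 2)))))).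

(** The variables range over all integers, so a negative value also counts as a violation. Only the
    failure of a square makes use of [y]. *)
Definition violation (a : atom nat) : pfml :=
  match a with
  | One u => POr (negative u) (neq (xvar u) (constant 1))
  | Add u v w => POr (negative u) (POr (negative v) (POr (negative w)
      (neq (LinXY (vadd (monomial u 1) (monomial v 1)) [] 0) (xvar w))))
  | Sq u w => POr (negative u) (POr (negative w) (not_square u w))
  end.

Definition below (b : nat) (a : atom nat) : Prop :=
  match a with
  | One u => u < b
  | Add u v w => u < b /\ v < b /\ w < b
  | Sq u w => u < b /\ w < b
  end%nat.

(** A variable beyond the [b] universal ones would be read as the default 0; well-formedness
    excludes it. *)
Lemma wf_violation_below b a : wf_pfml b b (violation a) -> below b a.
Proof.
  assert (H : forall i c, length (monomial i c) = S i).
  { intros i c. unfold monomial. rewrite length_app, repeat_length. cbn. lia. }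
  destruct a; cbn [violation negative wf_pfml below]; unfold wf_linxy; cbn [xvar lxy_xcoef];
    rewrite ?H; intuition lia.
Qed.

Definition square_violation (x z y : Z) : Prop :=
  ((x + 1 | y) /\ z + 3 * x + 2 < y < z + 4 * x + 3) \/
  ((x + 2 | y) /\ z + 3 * x + 2 < y < z + 4 * x + 4) \/
  ((x + 1 | y) /\ (x + 2 | y) /\ 0 < y < z + 3 * x + 2).

Lemma holds_not_square xs y ys x z : holds xs (y :: ys) (not_square x z) <->
  square_violation (nth x xs 0) (nth z xs 0) y.
Proof.
  assert (Ey : eval_linxy xs (y :: ys) yvar = y).
  { unfold eval_linxy, yvar. cbn [lxy_xcoef lxy_ycoef lxy_const dot]. lia. }
  assert (Et : forall n c, eval_linxy xs (y :: ys)
    (LinXY (vadd (monomial z 1) (monomial x n)) [] c) = nth z xs 0 + n * nth x xs 0 + c).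
  { intros n c. unfold eval_linxy. cbn [lxy_xcoef lxy_ycoef lxy_const].
    rewrite dot_vadd, !dot_monomial. cbn [dot]. lia. }
  assert (Ed : forall c, eval_linx xs (LinX (monomial x 1) c) = nth x xs 0 + c).
  { intros c. unfold eval_linx. cbn [lx_coef lx_const]. rewrite dot_monomial. lia. }
  unfold square_violation. cbn [not_square holds].
  rewrite !Ey, !Et, !Ed.
  change (eval_linxy xs (y :: ys) (constant 0)) with 0. reflexivity.
Qed.

Lemma consecutive_divide x y : (x + 1 | y) -> (x + 2 | y) -> ((x + 1) * (x + 2) | y).
Proof.
  intros [p Hp] [q Hq]. exists (p - q).
  transitivity (y * (x + 2) - y * (x + 1)); [ring|].
  rewrite Hp at 1. rewrite Hq at 1. ring.
Qed.

Lemma no_multiple_between d p y : (d | y) -> ~ (p * d < y < p * d + d).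
Proof. intros [q ->] H. assert (p < q) by nia. assert (q < p + 1) by nia. lia. Qed.

Lemma square_no_violation x y : 0 <= x -> ~ square_violation x (x * x) y.
Proof.
  intros Hx [[H1 H2]|[[H1 H2]|[H1 [H2 H3]]]].
  (* Here [t = (x + 1) * (x + 2)] is a multiple of both divisors, so each interval above [t] is a
     gap between multiples. *)
  - apply (no_multiple_between _ (x + 2) _ H1). nia.
  - apply (no_multiple_between _ (x + 1) _ H1). nia.
  - destruct (consecutive_divide _ _ H1 H2) as [q Hq].
    assert (1 <= q) by nia. nia.
Qed.

Lemma multiple_between d t : 0 < d -> (d | t) \/ exists y, (d | y) /\ t < y < t + d.
Proof.
  intros Hd. pose proof (Z.div_mod t d ltac:(lia)) as E.
  pose proof (Z.mod_pos_bound t d Hd) as B.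
  destruct (Z.eq_dec (t mod d) 0) as [H0|H0].
  - left. exists (t / d). lia.
  - right. exists ((t / d + 1) * d). split; [apply Z.divide_factor_r|]. lia.
Qed.

Lemma square_violation_exists x z : 0 <= x -> 0 <= z -> z <> x * x ->
  exists y, square_violation x z y.
Proof.
  intros Hx Hz Hne.
  destruct (multiple_between (x + 1) (z + 3 * x + 2) ltac:(lia)) as [H1|[y [H1 B]]].
  - destruct (multiple_between (x + 2) (z + 3 * x + 2) ltac:(lia)) as [H2|[y [H2 B]]].
    + destruct (consecutive_divide _ _ H1 H2) as [q Hq].
      (* [q = 1] would mean [z = x * x]; for [q >= 2] the product itself is a common multiple below
         [t]. *)
      assert (1 <= q) by nia. assert (q <> 1) by nia.
      exists ((x + 1) * (x + 2)). right. right.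
      split; [apply Z.divide_factor_l|]. split; [apply Z.divide_factor_r|]. nia.
    + exists y. right. left. split; [exact H2|lia].
  - exists y. left. split; [exact H1|lia].
Qed.

Lemma holds_lt xs ys f g : holds xs ys (PLt f g) <-> eval_linxy xs ys f < eval_linxy xs ys g.
Proof. reflexivity. Qed.

Lemma holds_neq xs ys f g : holds xs ys (neq f g) <-> eval_linxy xs ys f <> eval_linxy xs ys g.
Proof. cbn [neq holds]. lia. Qed.

Lemma eval_constant xs ys c : eval_linxy xs ys (constant c) = c.
Proof. reflexivity. Qed.

Lemma eval_xvar xs ys i : eval_linxy xs ys (xvar i) = nth i xs 0.
Proof.
  unfold eval_linxy, xvar. cbn [lxy_xcoef lxy_ycoef lxy_const].
  rewrite dot_monomial. cbn [dot]. lia.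
Qed.

Lemma eval_xsum xs ys i j :
  eval_linxy xs ys (LinXY (vadd (monomial i 1) (monomial j 1)) [] 0) = nth i xs 0 + nth j xs 0.
Proof.
  unfold eval_linxy. cbn [lxy_xcoef lxy_ycoef lxy_const].
  rewrite dot_vadd, !dot_monomial. cbn [dot]. lia.
Qed.

Lemma sat_no_violation (e : nat -> nat) b xs y ys a :
  (forall i, (i < b)%nat -> nth i xs 0 = Z.of_nat (e i)) -> below b a -> sat e a ->
  ~ holds xs (y :: ys) (violation a).
Proof.
  intros He Hb Ha.
  destruct a as [u|u v w|u w]; cbn [violation holds below sat] in *; unfold negative;
    rewrite ?holds_not_square, ?holds_neq, ?holds_lt, ?eval_constant, ?eval_xvar, ?eval_xsum;
    rewrite ?He by tauto; [lia|lia|].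
  intros [H|[H|H]]; [lia|lia|].
  rewrite <- Ha, Nat2Z.inj_mul in H. revert H. apply square_no_violation. lia.
Qed.

(** Only the first existential variable is read; [ys] is left free for padding to the prescribed
    length. *)
Lemma sat_or_violation xs a : sat (fun i => Z.to_nat (nth i xs 0)) a \/
  exists y, forall ys, holds xs (y :: ys) (violation a).
Proof.
  destruct a as [u|u v w|u w]; cbn [violation sat].
  - destruct (Z.eq_dec (nth u xs 0) 1) as [->|H]; [now left|].
    right. exists 0. intros ys. cbn [holds].
    rewrite holds_neq, eval_constant, eval_xvar. now right.
  - destruct (Z_lt_dec (nth u xs 0) 0) as [Hu|Hu], (Z_lt_dec (nth v xs 0) 0) as [Hv|Hv],
      (Z_lt_dec (nth w xs 0) 0) as [Hw|Hw],
      (Z.eq_dec (nth u xs 0 + nth v xs 0) (nth w xs 0)) as [E|E];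
      try (left; lia); right; exists 0; intros ys; cbn [holds]; unfold negative;
      rewrite holds_neq, !holds_lt, eval_constant, !eval_xvar, eval_xsum; lia.
  - destruct (Z_lt_dec (nth u xs 0) 0) as [Hu|Hu].
    { right. exists 0. intros ys. left. unfold negative.
      now rewrite holds_lt, eval_constant, eval_xvar. }
    destruct (Z_lt_dec (nth w xs 0) 0) as [Hw|Hw].
    { right. exists 0. intros ys. right. left. unfold negative.
      now rewrite holds_lt, eval_constant, eval_xvar. }
    destruct (Z.eq_dec (nth w xs 0) (nth u xs 0 * nth u xs 0)) as [E|E].
    + left. rewrite E. lia.
    + right. destruct (square_violation_exists (nth u xs 0) (nth w xs 0) ltac:(lia) ltac:(lia) E) as [y Hy].
      exists y. intros ys. right. right. now apply holds_not_square.
Qed.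

Definition violations (l : list (atom nat)) : pfml :=
  fold_right (fun a p => POr (violation a) p) (neq (constant 0) (constant 0)) l.

(** The outermost connective is always [POr], with tag 4. A positive code guarantees that [x_0] and
    a witness variable exist. *)
Lemma violations_ge l : (4 <= enc_pfml (violations l))%nat.
Proof. destruct l; cbn [violations fold_right neq enc_pfml]; apply cpair_ge. Qed.

Lemma sats_no_violations (e : nat -> nat) b xs y ys l :
  (forall i, (i < b)%nat -> nth i xs 0 = Z.of_nat (e i)) ->
  wf_pfml b b (violations l) -> sats e l -> ~ holds xs (y :: ys) (violations l).
Proof.
  intros He. induction l as [|a l IH]; cbn [violations fold_right wf_pfml holds].
  - intros _ _. rewrite holds_neq. auto.
  - intros [H1 H2] H. inversion H; subst. apply wf_violation_below in H1.
    intros [H3|H3]; [|now apply IH]. revert H3. now apply sat_no_violation with e b.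
Qed.

Lemma sats_or_violations xs l : sats (fun i => Z.to_nat (nth i xs 0)) l \/
  exists y, forall ys, holds xs (y :: ys) (violations l).
Proof.
  induction l as [|a l IH]; cbn [violations fold_right holds]; [left; constructor|].
  destruct (sat_or_violation xs a) as [H1|[y Hy]].
  - destruct IH as [H2|[y Hy]]; [left; now constructor|right; exists y; auto].
  - right. exists y. auto.
Qed.

End Violation.

Definition is_not (b : nat) : pfml := neq (xvar 0) (constant (Z.of_nat b)).

(* [enc_pfml p] bounds the variables of [p], so it can serve as the number of variables: the
   code of the sentence then depends on [p] only through [enc_pfml p]. *)
Definition diagonal (p : pfml) : sentence :=
  let b := enc_pfml p in Sentence b b (POr (is_not b) p).

Definition diagonal_code (b : nat) : nat :=
  cpair b (cpair b (cpair 4 (cpair (enc_pfml (is_not b)) b))).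

Lemma enc_diagonal p : enc_sentence (diagonal p) = diagonal_code (enc_pfml p).
Proof. reflexivity. Qed.

Lemma dio_diagonal_code {V : Set} (e : (V -> nat) -> nat) :
  DioFun e -> DioFun (fun r => diagonal_code (e r)).
Proof.
  intros He. unfold diagonal_code, is_not. cbn [neq enc_pfml].
  assert (Hc : forall b, enc_linxy (constant (Z.of_nat b)) = cpair 0 (cpair 0 (2 * b))).
  { intros b. unfold enc_linxy, encZ. cbn [constant lxy_xcoef lxy_ycoef lxy_const encZs].
    rewrite Nat2Z.id. destruct (Z.leb_spec 0 (Z.of_nat b)); [reflexivity|lia]. }
  assert (H : DioFun (fun r => enc_linxy (constant (Z.of_nat (e r))))).
  { apply dio_iff with (R' := fun r : option V -> nat =>
      r None = cpair 0 (cpair 0 (2 * e (fun v => r (Some v))))).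
    - intros r. now rewrite Hc.
    - exact (dio_cpair _ _ (dio_const 0) (dio_cpair _ _ (dio_const 0) (dio_mul _ _ (dio_const 2) He))). }
  repeat first [exact He | exact H | apply dio_cpair | apply dio_const].
Qed.

Lemma dio_solutions (R : nat -> Prop) : Dio (fun r : unit -> nat => R (r tt)) ->
  exists l : list (atom nat), forall b, R b <-> exists e, e 0 = b /\ sats e l.
Proof.
  intros [l H].
  exists (map (ren (fun x => match x with inl _ => 0 | inr i => S i end)) l).
  intros b. rewrite (H (fun _ => b)). split.
  - intros [m E]. exists (fun i => match i with 0 => b | S i => m i end).
    split; [reflexivity|]. apply sats_ren. revert E. apply sats_ext. intros [[]|i]; reflexivity.
  - intros [e [E0 E]]. exists (fun i => e (S i)). rewrite sats_ren in E.
    revert E. apply sats_ext. intros [[]|i]; auto.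
Qed.

(** The first disjunct settles all assignments with [x_0 <> b]. At [x_0 = b] the sentence denies
    that the system has a solution with first entry [b], which is [R b]. *)
Lemma true_diagonal (R : nat -> Prop) (l : list (atom nat)) :
  (forall b, R b <-> exists e, e 0 = b /\ sats e l) ->
  let p := violations l in true_sentence (diagonal p) <-> ~ R (enc_pfml p).
Proof.
  intros H p. set (b := enc_pfml p).
  assert (Hb : 4 <= b) by apply violations_ge.
  unfold true_sentence, diagonal. cbn [s_nx s_ny s_body holds]. fold b.
  rewrite H. split.
  - intros Ht [e [E0 Hs]].
    set (xs := map (fun i => Z.of_nat (e i)) (seq 0 b)).
    assert (Hx : forall i, i < b -> nth i xs 0%Z = Z.of_nat (e i)).
    { intros i Hi. unfold xs.
      rewrite nth_indep with (d' := Z.of_nat (e 0)) by (rewrite length_map, length_seq; exact Hi).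
      rewrite (map_nth (fun i => Z.of_nat (e i))), seq_nth by exact Hi. reflexivity. }
    destruct (Ht xs) as [[|y ys] [Hl Hh]]; [unfold xs; now rewrite length_map, length_seq| |].
    + cbn in Hl. lia.
    + destruct Hh as [Hh|Hh].
      * apply holds_neq in Hh. rewrite eval_xvar, eval_constant, Hx, E0 in Hh by lia. auto.
      * revert Hh. apply sats_no_violations with e b; auto. now apply wf_pfml_enc.
  - intros Hn xs Hxs.
    destruct (sats_or_violations xs l) as [Hs|[y Hy]].
    + exists (repeat 0%Z b). split; [apply repeat_length|]. left.
      apply holds_neq. rewrite eval_xvar, eval_constant. intros E. apply Hn.
      exists (fun i => Z.to_nat (nth i xs 0%Z)). split; [|exact Hs].
      rewrite E. apply Nat2Z.id.
    + exists (y :: repeat 0%Z (b - 1)). split; [cbn; rewrite repeat_length; lia|].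
      right. apply Hy.
Qed.

Lemma wf_diagonal l : wf_sentence (diagonal (violations l)).
Proof.
  pose proof (violations_ge l). unfold wf_sentence, diagonal.
  cbn [s_nx s_ny s_body wf_pfml is_not neq]. unfold wf_linxy. cbn.
  pose proof (wf_pfml_enc (violations l) _ (le_n _)). intuition lia.
Qed.

Theorem theorem2 : ~ exists P : program, decides_true_sentences P.
Proof.
  intros [P HP].
  destruct (dio_solutions (fun b => halts_with P (diagonal_code b) 1)) as [l Hl].
  { apply dio_halts_with; [apply dio_diagonal_code, dio_var|apply dio_const]. }
  pose proof (true_diagonal _ l Hl) as Ht. cbv beta zeta in Ht.
  rewrite <- enc_diagonal in Ht.
  destruct (HP _ (wf_diagonal l)) as [H1 H0].
  (* If the sentence were true, the output would be 1, which it denies. So it is false and the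
     output is 0; then the output is not 1, which makes it true. *)
  assert (Hf : ~ true_sentence (diagonal (violations l))).
  { intros H. exact (proj1 Ht H (H1 H)). }
  specialize (H0 Hf). apply Hf, Ht. intros H.
  discriminate (halts_with_unique _ _ _ _ H H0).
Qed.
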